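(* Let $E$ and $F$ be Banach spaces. Suppose $E$ and $F^*$ do not have the Schur property (neither of them has it), and $\mathcal{L}(F^*,E^{**})=\mathcal{L}_{\mathrm{cc}}(F^*,E^{**})$ (that is, every bounded linear operator from $F^*$ into $E^{**}$ is completely continuous). Then $E\widehat{\otimes}_\epsilon F$ does not have the Dunford-Pettis property.
   Context: $E\widehat{\otimes}_\epsilon F$ is the (completed) injective tensor product of $E$ and $F$. $E^*$, $E^{**}$ denote the dual and bidual of $E$. An operator is a bounded linear map; $\mathcal{L}(E,F)$ is the space of all operators from $E$ into $F$. An operator is completely continuous if it takes weak Cauchy sequences into norm Cauchy sequences; $\mathcal{L}_{\mathrm{cc}}(E,F)$ is the space of completely continuous operators from $E$ into $F$. A Banach space $E$ has the Dunford-Pettis property if every weakly compact operator from $E$ into any Banach space is completely continuous; equivalently, $\lim_n\phi_n(x_n)=0$ for all weakly null sequences $(x_n)\subset E$ and $(\phi_n)\subset E^*$. A Banach space has the Schur property if every weakly convergent sequence in it converges in norm. *)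

(* Defs.v *)
From HB Require Import structures.
From mathcomp Require Import all_boot all_order all_algebra.
From mathcomp Require Import complex.
From mathcomp Require Import all_classical all_reals all_analysis.

Set Implicit Arguments.
Unset Strict Implicit.
Unset Printing Implicit Defensive.

Import Order.TTheory GRing.Theory Num.Theory.
Import numFieldNormedType.Exports.

Local Open Scope classical_set_scope.
Local Open Scope ring_scope.

(* Banach spaces are taken over R or over C: a Banach space is a
   [completeNormedModType (scalars R k)]. Norms take their values in the scalar
   field, where they are nonnegative reals. *)
Variant scalar_kind := RealScalars | ComplexScalars.

Definition scalars (R : realType) (k : scalar_kind) : numFieldType :=
  match k with RealScalars => R | ComplexScalars => R[i] end.

Lemma scalars_supremums (R : realType) (k : scalar_kind)
    (A : set (scalars R k)) (c : scalars R k) :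
  A !=set0 -> (forall x, A x -> 0 <= x <= c) -> supremums A !=set0.
Proof.
case: k A c => /= A c [x0 Ax0] Ac.
  have ubA : has_sup A.
    by split; [exists x0 | exists c => x /Ac/andP[]].
  exists (sup A); split; first exact: sup_upper_bound.
  by move=> y Ay; apply: ge_sup => //; exists x0.
have AE x : A x -> x = (complex.Re x)%:C%C.
  by move=> /Ac/andP[+ _]; case: x => a b; rewrite lecE /= => /andP[/eqP -> _].
pose B := [set complex.Re x | x in A].
have B0 : B !=set0 by exists (complex.Re x0), x0.
have ubB : has_sup B.
  split=> //; exists (complex.Re c) => _ [x /Ac/andP[_ +] <-].
  by rewrite lecE => /andP[].
exists (sup B)%:C%C; split=> [x Ax|y Ay].
  by rewrite (AE _ Ax) lecR; apply: (sup_upper_bound ubB); exists x.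
have := Ay _ Ax0; rewrite {1}(AE _ Ax0) lecE /= => /andP[/eqP y0 _].
rewrite lecE /= y0 eqxx /=; apply: ge_sup => // _ [x /Ay + <-].
by rewrite lecE => /andP[].
Qed.

Section Operators.
Context {R : realType} {k : scalar_kind}.
Local Notation K := (scalars R k).

Section OperatorSpace.
Variables E F : normedModType K.

Definition bounded_linear : {pred E -> F} :=
  fun f => `[< linear f /\ exists M : K, forall x, `|f x| <= M * `|x| >].

Record operator := Operator {
  operator_fun :> E -> F ;
  operatorP : operator_fun \in bounded_linear }.

HB.instance Definition _ := [isSub for operator_fun].
HB.instance Definition _ := gen_eqMixin operator.
HB.instance Definition _ := gen_choiceMixin operator.

Lemma bounded_linear_submod : submod_closed bounded_linear.
Proof.
split.
  apply/asboolP; split=> [a x y /=|]; first by rewrite scaler0 addr0.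
  by exists 0 => x; rewrite normr0 mul0r.
move=> a f g /asboolP[lf [M Mf]] /asboolP[lg [N Ng]]; apply/asboolP; split.
  move=> b x y; rewrite /= -[LHS]/(a *: f _ + g _) lf lg.
  rewrite -[in RHS]/(b *: (a *: f x + g x) + (a *: f y + g y)).
  by rewrite !scalerDr !scalerA [b * a]mulrC addrACA.
exists (`|a| * M + N) => x; rewrite -[(_ + _) x]/(a *: f x + g x).
rewrite (le_trans (ler_normD _ _))// mulrDl lerD// normrZ -mulrA.
by rewrite ler_wpM2l.
Qed.

HB.instance Definition _ :=
  GRing.isSubmodClosed.Build K (E -> F) bounded_linear bounded_linear_submod.
HB.instance Definition _ := [SubChoice_isSubLmodule of operator by <:].

Definition op_norm (T : operator) : K :=
  supremum 0 [set `|T x| | x in [set x : E | `|x| <= 1]].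

Lemma operator_linear (T : operator) : linear T.
Proof. by have /asboolP[] := operatorP T. Qed.

Lemma operatorZ (T : operator) (a : K) x : T (a *: x) = a *: T x.
Proof.
have T0 : T 0 = 0.
  by have := operator_linear T (-1) 0 0; rewrite scaler0 addr0 scaleN1r addNr.
by have := operator_linear T a x 0; rewrite !addr0 T0 addr0.
Qed.

Lemma op_norm_supremums (T : operator) :
  supremums [set `|T x| | x in [set x : E | `|x| <= 1]] (op_norm T).
Proof.
have [_ [M TM]] := asboolP _ (operatorP T).
rewrite /op_norm /supremum; case: ifPn => [/eqP S0|/set0P Sn0].
  have : [set `|T x| | x in [set x : E | `|x| <= 1]] `|T 0|.
    by exists 0 => //=; rewrite normr0.
  by rewrite S0.
have [s] : supremums [set `|T x| | x in [set x : E | `|x| <= 1]] !=set0.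
  apply: (@scalars_supremums R k _ `|M|) => // _ [x x1 <-]; rewrite normr_ge0 /=.
  have /real_ler_norm MM : M * `|x| \is Num.real.
    by rewrite ger0_real// (le_trans _ (TM x)).
  rewrite (le_trans (TM x))// (le_trans MM)// normrM normr_id.
  by rewrite ler_piMr.
exact: xgetI.
Qed.

Lemma le_op_norm (T : operator) x : `|T x| <= op_norm T * `|x|.
Proof.
have [ubT _] := op_norm_supremums T.
have [->|x0] := eqVneq x 0.
  have -> : T 0 = 0 by rewrite -[X in T X](scale0r 0) operatorZ scale0r.
  by rewrite !normr0 mulr0.
have nx0 : 0 < `|x| by rewrite normr_gt0.
have /= := ubT `|T (`|x|^-1 *: x)|.
rewrite operatorZ normrZ normfV normr_id mulrC ler_pdivrMr//; apply.
exists (`|x|^-1 *: x); last by rewrite operatorZ normrZ normfV normr_id mulrC.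
by rewrite /= normrZ normfV normr_id mulVf// gt_eqF.
Qed.

Lemma op_norm_le (T : operator) (c : K) :
  (forall x, `|x| <= 1 -> `|T x| <= c) -> op_norm T <= c.
Proof.
by move=> Tc; have [_] := op_norm_supremums T; apply=> _ [x /Tc ? <-].
Qed.

Lemma op_norm_ge0 (T : operator) : 0 <= op_norm T.
Proof.
have [+ _] := op_norm_supremums T; move=> /(_ `|T 0|) T0.
by rewrite (le_trans _ (T0 _))//; exists 0 => //=; rewrite normr0.
Qed.

Lemma op_normD (S T : operator) : op_norm (S + T) <= op_norm S + op_norm T.
Proof.
apply: op_norm_le => x x1; rewrite (_ : (S + T) x = S x + T x)//.
rewrite (le_trans (ler_normD _ _))// lerD//;
  by rewrite (le_trans (le_op_norm _ _))// ler_piMr// op_norm_ge0.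
Qed.

Lemma op_normZ (a : K) (T : operator) : op_norm (a *: T) = `|a| * op_norm T.
Proof.
have le_normZ (b : K) (S : operator) : op_norm (b *: S) <= `|b| * op_norm S.
  apply: op_norm_le => x x1; rewrite (_ : (b *: S) x = b *: S x)// normrZ.
  by rewrite ler_wpM2l// (le_trans (le_op_norm _ _))// ler_piMr// op_norm_ge0.
apply/le_anti; rewrite le_normZ /=.
have [->|a0] := eqVneq a 0; first by rewrite normr0 mul0r op_norm_ge0.
have := le_normZ a^-1 (a *: T); rewrite scalerA mulVf// scale1r normfV.
by rewrite ler_pdivlMl// normr_gt0.
Qed.

Lemma op_norm_eq0 (T : operator) : op_norm T = 0 -> T = 0.
Proof.
move=> T0; apply: val_inj; apply/funext => x /=.
by apply/eqP; rewrite -normr_le0 -(mul0r `|x|) -T0 le_op_norm.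
Qed.

HB.instance Definition _ :=
  Lmodule_isNormed.Build K operator op_normD op_normZ op_norm_eq0.

End OperatorSpace.

Definition dual (E : normedModType K) : Type := operator E K^o.
HB.instance Definition _ (E : normedModType K) :=
  NormedModule.copy (dual E) (operator E K^o).

Definition bidual (E : normedModType K) : Type := dual (dual E).
HB.instance Definition _ (E : normedModType K) :=
  NormedModule.copy (bidual E) (dual (dual E)).

Definition weakly_converges (E : normedModType K) (x : nat -> E) (l : E) :=
  forall phi : dual E, phi (x n) @[n --> \oo] --> phi l.

Definition weakly_cauchy (E : normedModType K) (x : nat -> E) :=
  forall phi : dual E, cauchy (phi (x n) @[n --> \oo]).

Definition schur_property (E : normedModType K) :=
  forall x : nat -> E,
    (exists l, weakly_converges x l) -> cvg (x n @[n --> \oo]).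

Definition completely_continuous (E F : normedModType K) (T : operator E F) :=
  forall x : nat -> E, weakly_cauchy x -> cauchy (T (x n) @[n --> \oo]).

(* [weak E] is the space E with its weak topology sigma(E, E^* ). *)
Definition weak (E : normedModType K) : Type :=
  initial_topology ((fun x phi => phi x) : E -> {ptws dual E -> K^o}).
HB.instance Definition _ (E : normedModType K) :=
  Topological.copy (weak E)
    (initial_topology ((fun x phi => phi x) : E -> {ptws dual E -> K^o})).

Lemma weakly_convergesP (E : normedModType K) (x : nat -> E) (l : E) :
  weakly_converges x l <-> (x : nat -> weak E) @ \oo --> (l : weak E).
Proof.
pose ev : weak E -> {ptws dual E -> K^o} := fun x phi => phi x.
have ev_cont : continuous ev by exact: initial_continuous.
split=> [xl|xl phi].
  have evxl : ev \o x @ \oo --> ev l.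
    by apply/(@pointwise_cvgP _ K^o (ev \o x @ \oo) (ev l)) => phi; exact: xl.
  move=> U; rewrite nbhsE => -[_ [[V Vo <-] Vl] VU].
  have /evxl : nbhs (ev l) V by exact: open_nbhs_nbhs.
  move=> H; apply: (@filterS nat \oo _ (x @^-1` (ev @^-1` V))); last exact: H.
  by move=> n; exact: VU.
have : ev \o x @ \oo --> ev l by exact: continuous_cvg (ev_cont l) xl.
by move=> /pointwise_cvgP/(_ phi).
Qed.

Definition weakly_compact (E F : normedModType K) (T : operator E F) :=
  precompact ([set T x | x in [set x : E | `|x| <= 1]] : set (weak F)).

Definition dunford_pettis_property (E : normedModType K) :=
  forall (F : completeNormedModType K) (T : operator E F),
    weakly_compact T -> completely_continuous T.

(* The injective norm of the tensor sum_i x_i (x) y_i, represented by the list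
   of the pairs (x_i, y_i). *)
Definition injective_norm (E F : normedModType K) (s : seq (E * F)) : K :=
  supremum 0 [set r | exists (phi : dual E) (psi : dual F),
    [/\ `|phi| <= 1, `|psi| <= 1
      & r = `|\sum_(p <- s) phi p.1 * psi p.2| ]].

(* G, with t x y in the role of the elementary tensor of x and y, is a completion
   of the algebraic tensor product of E and F for the injective norm. As the
   latter is a norm, [inj_tensor_norm] says that the linear map from the algebraic
   tensor product to G induced by t is injective and isometric. *)
Record is_injective_tensor_product (E F G : completeNormedModType K)
    (t : {bilinear E -> F -> G}) : Prop := {
  inj_tensor_norm : forall s : seq (E * F),
    `|\sum_(p <- s) t p.1 p.2| = injective_norm s ;
  inj_tensor_dense :
    dense [set \sum_(p <- s) t p.1 p.2 | s in [set: seq (E * F)]] }.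

End Operators.

(* Main.v *)
Require Import Defs.
From HB Require Import structures.
From mathcomp Require Import all_boot all_order all_algebra.
From mathcomp Require Import complex ring lra.
From mathcomp Require Import all_classical all_reals all_analysis.
Set Implicit Arguments.
Unset Strict Implicit.
Unset Printing Implicit Defensive.
Import Order.TTheory GRing.Theory Num.Theory.
Import numFieldNormedType.Exports.
Local Open Scope classical_set_scope.
Local Open Scope ring_scope.

(** Write B for the unit ball of the dual of E, and xi (x) psi for the functional
    on the injective tensor product that sends x (x) y to xi x * psi y.

    As E and the dual of F are not Schur spaces, they contain weakly null
    sequences (x_n) and (psi_n) of unit vectors. By Hahn-Banach there are xi_n in
    the unit ball of the dual of E with |xi_n x_n| = 1, and by the definition of
    the operator norm there are y_n in the unit ball of F with |psi_n y_n| >= 1/2.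
    The tensors x_n (x) y_n and the functionals xi_n (x) psi_n then pair to
    numbers of modulus at least 1/2, so the Dunford-Pettis property fails as soon
    as both sequences are weakly null.

    - The functionals are weakly null ([tensor_functional_weakly_null]): a
      functional z on the dual of the tensor product induces the operator
      psi |-> (xi |-> z (xi (x) psi)) from the dual of F to the bidual of E. It is
      completely continuous by hypothesis, so it sends (psi_n) to a norm null
      sequence, and z (xi_n (x) psi_n) tends to 0 uniformly in the xi_n.

    - The tensors are weakly null ([tensor_weakly_null]) for any bounded (y_n). A
      functional phi on the injective tensor product is usually represented by a
      measure on the product of the two dual balls, and dominated convergence
      concludes. Measures can be avoided: if |phi (x_n (x) y_n)| >= d for all n,
      testing phi on convex combinations bounds from below the supremum over B of
      every convex combination of the functions xi |-> |xi x_n|. The lemma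
      [convex_block_sequence], a variant of Simons's inequality, then gives blocks
      of combinations, further and further away, that are simultaneously bounded
      below at one point of B, up to weak-star compactness; this contradicts the
      pointwise convergence of xi x_n to 0.

    The Dunford-Pettis property is defined by weakly compact operators, and
    [dunford_pettis_pairing] translates it: a weakly null sequence (Phi_n) in a
    dual ball defines the operator u |-> (Phi_n u)_n into the space c0 of null
    sequences. Its bitranspose still has values in c0, because (Phi_n) is null
    against the bidual, and the image of the bidual ball is weakly compact by
    Alaoglu, so the operator is weakly compact. *)

(** * Convex blocks that are large at a common point *)

Section ConvexBlocks.
Context {R : realType} {X : Type}.
Implicit Types (f g h : X -> R).

Lemma le_sup_range f (M : R) : (forall x, f x <= M) -> forall x, f x <= sup (range f).
Proof.
move=> fM x; apply: sup_upper_bound; last by exists x.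
by split; [exists (f x); exists x | exists M => _ [y _ <-]].
Qed.

Lemma sup_range_le (x0 : X) f (M : R) : (forall x, f x <= M) -> sup (range f) <= M.
Proof. by move=> fM; apply: ge_sup; [exists (f x0); exists x0 | move=> _ [y _ <-]]. Qed.

Lemma sup_range_adherent (x0 : X) f (M e : R) : (forall x, f x <= M) -> 0 < e ->
  exists x, sup (range f) - e < f x.
Proof.
move=> fM e0; have [|_ [x _ <-] ?] := @sup_adherent _ (range f) e e0.
  by split; [exists (f x0); exists x0 | exists M => _ [y _ <-]].
by exists x.
Qed.

Variables (C : nat -> set (X -> R)) (m : R).
Hypotheses (C0 : forall k, C k !=set0) (Cdecr : forall k, C k.+1 `<=` C k).
Hypothesis C01 : forall k g x, C k g -> 0 <= g x <= 1.
Hypothesis Cconv : forall k f g (t : R), 0 <= t <= 1 -> C k f -> C k g ->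
  C k (fun x => (1 - t) * f x + t * g x).
Hypotheses (m0 : 0 < m) (Cm : forall g, C 0 g -> exists x, m <= g x).

Let l := m / 8.
Let S f := sup (range f).
Let eps k := l ^+ k.+1 * m * (2^-1 ^+ k / 8).

Let m1 : m <= 1.
Proof.
have [g Cg] := C0 0; have [x mx] := Cm Cg.
by have /andP[_] := C01 x Cg; exact: le_trans.
Qed.

Let l0 : 0 < l. Proof. by rewrite divr_gt0. Qed.

Let eps0 k : 0 < eps k.
Proof. by rewrite /eps !mulr_gt0 ?exprn_gt0// invr_gt0. Qed.

Let nearmin k h (M : R) : (forall x, 0 <= h x <= M) -> exists g, C k g /\
  forall g', C k g' -> S (fun x => h x + l ^+ k * g x) <= S (fun x => h x + l ^+ k * g' x) + eps k.
Proof.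
move=> hM.
have [g0 Cg0] := C0 0; have [x0 _] := Cm Cg0.
have lk0 : 0 <= l ^+ k by rewrite exprn_ge0// ltW.
pose V := [set S (fun x => h x + l ^+ k * g x) | g in C k].
have infV : has_inf V.
  have [g Cg] := C0 k.
  split; first by exists (S (fun x => h x + l ^+ k * g x)), g.
  exists 0 => _ [f Cf <-].
  apply: (@le_trans _ _ (h x0 + l ^+ k * f x0)).
    rewrite addr_ge0 ?mulr_ge0//; first by have /andP[] := hM x0.
    by have /andP[] := C01 x0 Cf.
  apply: (@le_sup_range _ (M + l ^+ k)) => x.
  have /andP[_ ?] := C01 x Cf; have /andP[_ ?] := hM x.
  by rewrite lerD// ler_piMr.
have [_ [g Cg <-] gV] := inf_adherent (eps0 k) infV.
exists g; split=> // g' Cg'; rewrite (le_trans (ltW gV))// lerD2r.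
by apply: inf_lbound; [have [] := infV | exists g'].
Qed.

(** A finitary form of Simons's inequality. Let h_k be the sum of the l ^+ j * g_j
    for j < k, and S the supremum; g_k is chosen in C k so as to nearly minimise
    S (h_k + l ^+ k * g). Since C k is convex and contains C k.+1, minimality at
    step k compares h_(k+1) with a convex combination of h_k and h_(k+2); hence the
    increments of S h_k decrease no faster than a multiple of l ^+ k. At a point x
    where the last sum is almost maximal, the increment from S h_k to S h_(k+1) can
    only come from g_k x, because the later terms are small compared with
    l ^+ k. *)
Lemma convex_block_sequence : exists g : nat -> X -> R,
  (forall k, C k (g k)) /\ forall K, exists x, forall k, (k <= K)%N -> m / 4 <= g k x.
Proof.
have [m0' m1' l0'] : [/\ 0 < m, m <= 1 & 0 < l] by [].
have [g0 Cg0] := C0 0; have [x0 _] := Cm Cg0.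
have /choice[sel selP] : forall kh : nat * (X -> R), exists g, C kh.1 g /\
    ((exists M, forall x, 0 <= kh.2 x <= M) -> forall g', C kh.1 g' ->
     S (fun x => kh.2 x + l ^+ kh.1 * g x) <= S (fun x => kh.2 x + l ^+ kh.1 * g' x) + eps kh.1).
  move=> [k h] /=; have [[M hM]|nh] := pselect (exists M, forall x, 0 <= h x <= M).
    by have [g [Cg gP]] := nearmin k hM; exists g; split=> // _.
  by have [g Cg] := C0 k; exists g; split=> // hh.
pose h := fix h k : X -> R :=
  if k is k'.+1 then fun x => h k' x + l ^+ k' * sel (k', h k') x else fun=> 0.
pose g k := sel (k, h k).
have Cg k : C k (g k) by have [] := selP (k, h k).
have g0P k x : 0 <= g k x by have /andP[] := C01 x (Cg k).
have g1P k x : g k x <= 1 by have /andP[] := C01 x (Cg k).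
have lk0 k : 0 < l ^+ k by rewrite exprn_gt0.
have l1 : l <= 8^-1 by rewrite /l; lra.
have lk1 k : l ^+ k <= 1 by rewrite exprn_ile1//; lra.
have hS k x : h k.+1 x = h k x + l ^+ k * g k x by [].
have hM k x : 0 <= h k x <= k%:R.
  elim: k => [|k /andP[IH1 IH2]]; first by rewrite lexx.
  rewrite hS addr_ge0 ?mulr_ge0 ?(ltW (lk0 k))//= -natr1 lerD//.
  by rewrite mulr_ile1// ltW.
have hM' k x : h k x <= k%:R by case/andP: (hM k x).
have gmin k g' : C k g' -> S (h k.+1) <= S (fun x => h k x + l ^+ k * g' x) + eps k.
  by have [_ /=] := selP (k, h k); apply; exists k%:R => x; exact: hM.
have leS k x : h k x <= S (h k) by apply: (@le_sup_range _ k%:R).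
have Smono k : S (h k) <= S (h k.+1).
  apply: (sup_range_le x0) => x; apply: le_trans (leS k.+1 x).
  by rewrite hS lerDl mulr_ge0// ltW.
have Sle k K : (k <= K)%N -> S (h k) <= S (h K).
  by move=> /subnK <-; elim: (K - k)%N => //= n IH; apply: le_trans (Smono _).
pose D k := S (h k.+1) - S (h k).
have D0 : m <= D 0%N.
  have [x mx] := Cm (Cg 0%N); rewrite /D.
  have -> : S (h 0%N) = 0.
    by apply/le_anti; rewrite (sup_range_le x0)//= (leS 0 x0).
  by rewrite subr0; apply: le_trans (leS 1%N x); rewrite hS /= add0r expr0 mul1r.
(* Minimality of g_k against the average q of g_k and g_(k+1) in C k. *)
have DS k : l * D k - (1 + l) * eps k <= D k.+1.
  pose q x := (1 - l / (1 + l)) * g k x + (l / (1 + l)) * g k.+1 x.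
  have Cq : C k q.
    apply: Cconv => //; last exact: Cdecr.
    by apply/andP; split; [apply: divr_ge0; lra | rewrite ler_pdivrMr; lra].
  have qle : S (fun x => h k x + l ^+ k * q x) <=
      (l * S (h k) + S (h k.+2)) / (1 + l).
    apply: (sup_range_le x0) => x; rewrite ler_pdivlMr; last by lra.
    have -> : (h k x + l ^+ k * q x) * (1 + l) = l * h k x + h k.+2 x.
      by rewrite !hS exprS /q; field; apply: lt0r_neq0; lra.
    by rewrite lerD// ler_wpM2l// ltW.
  have := le_trans (gmin k q Cq) (lerD qle (lexx (eps k))).
  rewrite -lerBlDr ler_pdivlMr; last by lra.
  by rewrite /D => ?; nra.
(* The summable part 2^-1 ^+ k absorbs the errors eps, and leaves half of m. *)
have Dk k : l ^+ k * m * (2^-1 + 2^-1 * 2^-1 ^+ k) <= D k.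
  elim: k => [|k IH]; first by rewrite !expr0; move: D0; lra.
  apply: le_trans (DS k).
  have := ler_wpM2l (ltW l0) IH.
  have : (1 + l) * eps k <= 2 * eps k by rewrite ler_wpM2r ?(ltW (eps0 k))//; lra.
  rewrite /eps !exprS => h1 h2.
  apply: le_trans (lerB h2 h1).
  by rewrite le_eqVlt; apply/orP; left; apply/eqP; field.
exists g; split=> // K.
have e0 : 0 < l ^+ K * (m / 16) by rewrite mulr_gt0//; lra.
have [x hx] := sup_range_adherent x0 (hM' K.+1) e0; exists x => k kK.
(* 8 / 7 bounds 1 / (1 - l), since l <= 1 / 8. *)
have tail j : h (k.+1 + j)%N x <= h k.+1 x + l ^+ k * (l * (8 / 7)) * (1 - l ^+ j).
  elim: j => [|j IH]; first by rewrite addn0 expr0 subrr mulr0 addr0.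
  rewrite addnS hS.
  have : l ^+ (k.+1 + j) * g (k.+1 + j)%N x <= l ^+ (k.+1 + j).
    by rewrite ler_piMr// ltW.
  move/(lerD IH)/le_trans; apply; rewrite exprD !exprS.
  have p0 : 0 <= l ^+ k * l ^+ j * l by rewrite !mulr_ge0// ltW.
  rewrite -subr_ge0; set a := l ^+ k; set b := l ^+ j.
  rewrite (_ : _ - _ = (a * b * l) * (8 / 7 * (1 - l) - 1)); last by ring.
  by rewrite mulr_ge0//; lra.
have {}tail : h K.+1 x <= h k.+1 x + l ^+ k * (m / 7).
  have := tail (K - k)%N; rewrite addSn subnKC// => /le_trans; apply.
  rewrite lerD2l -mulrA ler_wpM2l ?(ltW (lk0 k))//.
  have : 0 <= l ^+ (K - k) <= 1 by rewrite lk1 ltW.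
  by rewrite {1 3}/l => /andP[? ?]; nra.
rewrite -(ler_pM2l (lk0 k)).
have h1 : l ^+ K * (m / 16) <= l ^+ k * (m / 16).
  rewrite ler_wpM2r//; first by lra.
  by rewrite ler_wiXn2l// ?ltW//; lra.
have h2 : l ^+ k * (m / 2) <= D k.
  apply: le_trans (Dk k); rewrite -mulrA ler_wpM2l ?(ltW (lk0 k))//.
  have : 0 <= (2^-1 : R) ^+ k by rewrite exprn_ge0.
  by move=> ?; nra.
have h3 := Sle k.+1 K.+1 kK; have h4 := leS k x.
move: hx; rewrite -/(S (h K.+1)) => hx.
move: h2; rewrite /D => h2; rewrite (hS k) in tail.
(* The increment m / 2 loses m / 16 to the choice of x and m / 7 to the tail. *)
have -> : l ^+ k * (m / 4) =
    l ^+ k * (m / 2) - l ^+ k * (m / 16) - l ^+ k * (m / 7)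
    - l ^+ k * (m * (1/4 - 1/16 - 1/7)) by field.
have h5 : 0 <= l ^+ k * (m * (1/4 - 1/16 - 1/7)) by rewrite mulr_ge0 ?(ltW (lk0 k))//; lra.
by lra.
Qed.
End ConvexBlocks.

(** * Hahn-Banach *)

Section HahnBanach.
Context {R : realType} {K : numFieldType} (iota : {rmorphism R -> K}) {E : lmodType K}.
Implicit Types (p q : E -> R) (x y : E).

Definition sublinear p :=
  (forall x y, p (x + y) <= p x + p y) /\
  (forall t x, 0 <= t -> p (iota t *: x) <= t * p x).

Lemma sublinear0 p : sublinear p -> p 0 = 0.
Proof.
move=> [pD pZ]; have := pD 0 0; have := pZ 0 0 (lexx 0).
by rewrite scaler0 mul0r addr0; lra.
Qed.

Lemma sublinearZ p t x : sublinear p -> 0 <= t -> p (iota t *: x) = t * p x.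
Proof.
move=> sp; rewrite le0r => /predU1P[->|t0].
  by rewrite rmorph0 scale0r mul0r sublinear0.
apply/le_anti; rewrite (sp.2 _ _ (ltW t0))/=.
have t0' : 0 <= t^-1 by rewrite invr_ge0 ltW.
have := sp.2 _ (iota t *: x) t0'.
by rewrite scalerA -rmorphM mulVf ?gt_eqF// rmorph1 scale1r ler_pdivlMl.
Qed.

Lemma sublinear_geN p x : sublinear p -> - p (- x) <= p x.
Proof.
by move=> sp; have := sp.1 x (- x); rewrite subrr sublinear0//; lra.
Qed.

(** The infimum makes p minimal along the direction y: tilt p y (- y) <= - p y. *)
Definition tilt p y x := inf [set p (x + iota t *: y) - t * p y | t in [set t | 0 <= t]].

Lemma tilt_lbound p y x t : sublinear p -> 0 <= t ->
  - p (- x) <= p (x + iota t *: y) - t * p y.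
Proof.
move=> sp t0; have := sp.1 (x + iota t *: y) (- x).
by rewrite addrAC subrr add0r sublinearZ//; lra.
Qed.

Lemma tilt_has_inf p y x : sublinear p ->
  has_inf [set p (x + iota t *: y) - t * p y | t in [set t | 0 <= t]].
Proof.
move=> sp; split; first by exists (p (x + iota 0 *: y) - 0 * p y), 0 => /=.
by exists (- p (- x)) => _ [t /= t0 <-]; exact: tilt_lbound.
Qed.

Lemma tilt_le p y x t : sublinear p -> 0 <= t ->
  tilt p y x <= p (x + iota t *: y) - t * p y.
Proof.
by move=> sp t0; apply: inf_lbound; [have [] := tilt_has_inf y x sp | exists t].
Qed.

Lemma le_tilt p y x (c : R) :
  (forall t, 0 <= t -> c <= p (x + iota t *: y) - t * p y) -> c <= tilt p y x.
Proof.
move=> cP; apply: lb_le_inf; first by exists (p (x + iota 0 *: y) - 0 * p y), 0 => /=.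
by move=> _ [t /= t0 <-]; exact: cP.
Qed.

Lemma tilt_sublinear p y : sublinear p -> sublinear (tilt p y).
Proof.
move=> sp; split=> [x x'|s x].
  rewrite -lerBlDr; apply: le_tilt => t t0; rewrite lerBlDr -lerBlDl.
  apply: le_tilt => t' t'0; rewrite lerBlDl.
  apply: le_trans (tilt_le _ _ sp (addr_ge0 t0 t'0)) _.
  have := sp.1 (x + iota t *: y) (x' + iota t' *: y).
  by rewrite addrACA -scalerDl -rmorphD mulrDl; lra.
rewrite le0r => /predU1P[->|s0].
  rewrite rmorph0 scale0r mul0r (le_trans (tilt_le _ _ sp (lexx 0)))//.
  by rewrite rmorph0 scale0r addr0 mul0r subr0 sublinear0.
rewrite -ler_pdivrMl//; apply: le_tilt => t t0.
rewrite ler_pdivrMl//; have st0 : 0 <= s * t by rewrite mulr_ge0// ltW.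
apply: le_trans (tilt_le _ _ sp st0) _.
by rewrite rmorphM -scalerA -scalerDr mulrBr mulrA lerB// (sublinearZ _ sp)// ltW.
Qed.

Lemma tilt_le_self p y x : sublinear p -> tilt p y x <= p x.
Proof.
move=> sp; apply: le_trans (tilt_le _ _ sp (lexx 0)) _.
by rewrite rmorph0 scale0r addr0 mul0r subr0.
Qed.

(** By Zorn's lemma there is a minimal sublinear p below q. It equals each of its
    tilts, hence is odd, and an odd sublinear function is linear. *)
Lemma sublinear_ge_linear q : sublinear q -> exists f : E -> R,
  [/\ forall x y, f (x + y) = f x + f y,
      forall t x, f (iota t *: x) = t * f x & forall x, f x <= q x].
Proof.
move=> sq.
pose T := {p : E -> R | sublinear p /\ forall x, p x <= q x}.
pose le_T (p p' : T) := `[< forall x, sval p' x <= sval p x >].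
have [p|r s t /asboolP h1 /asboolP h2|s t /asboolP h1 /asboolP h2|A Atot|p pmin] :=
  @Zorn T le_T.
- exact/asboolP.
- by apply/asboolP => x; apply: le_trans (h2 x) (h1 x).
- case: s t h1 h2 => [s Ps] [t Pt] /= h1 h2; apply: eq_exist; apply/funext => x.
  by apply/le_anti; rewrite h1 h2.
- have [[p0 Ap0]|A0] := pselect (A !=set0); last first.
    exists (exist _ q (conj sq (fun x => lexx (q x)))) => s As.
    by exfalso; apply: A0; exists s.
  pose V x := [set sval (p : T) x | p in A].
  have Vinf x : has_inf (V x).
    split; first by exists (sval p0 x), p0.
    exists (- q (- x)) => _ [p Ap <-]; have [sp pq] := svalP p.
    by apply: le_trans (sublinear_geN x sp); rewrite lerN2.
  have Vle x (p : T) : A p -> inf (V x) <= sval p x.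
    by move=> Ap; apply: inf_lbound; [have [] := Vinf x | exists p].
  have leV x c : (forall p : T, A p -> c <= sval p x) -> c <= inf (V x).
    by move=> cP; apply: lb_le_inf; [have [] := Vinf x | move=> _ [p /cP ? <-]].
  have sV : sublinear (fun x => inf (V x)).
    split=> [x y|t x t0].
      rewrite -lerBlDr; apply: (leV) => p Ap; rewrite lerBlDr -lerBlDl.
      apply: (leV) => p' Ap'; rewrite lerBlDl.
      have [/asboolP pp|/asboolP pp] := Atot p p' Ap Ap'.
        apply: le_trans (Vle _ _ Ap') _; have := (svalP p').1.1 x y.
        by have := pp x; lra.
      apply: le_trans (Vle _ _ Ap) _; have := (svalP p).1.1 x y.
      by have := pp y; lra.
    have [->|t1] := eqVneq t 0.
      rewrite rmorph0 scale0r mul0r; apply: le_trans (Vle _ _ Ap0) _.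
      by rewrite sublinear0//; have [] := svalP p0.
    have {}t0 : 0 < t by rewrite lt0r t1.
    rewrite -ler_pdivrMl//; apply: (leV) => p Ap; rewrite ler_pdivrMl//.
    apply: le_trans (Vle _ _ Ap) _; have [sp _] := svalP p.
    by rewrite (sublinearZ _ sp)// ltW.
  have Vq x : inf (V x) <= q x.
    by apply: le_trans (Vle _ _ Ap0) _; have [_] := svalP p0.
  exists (exist _ (fun x => inf (V x)) (conj sV Vq)) => s As; apply/asboolP => x /=; exact: Vle.
case: p pmin => /= p [sp pq] pmin.
have tiltp y : tilt p y = p.
  have tq x : tilt p y x <= q x by apply: le_trans (tilt_le_self _ _ sp) _.
  have := pmin (exist _ (tilt p y) (conj (tilt_sublinear y sp) tq)).
  by move=> h; apply: (congr1 sval (h _)); apply/asboolP => x /=; exact: tilt_le_self.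
have pN y : p (- y) = - p y.
  apply/le_anti/andP; split; last by have := sublinear_geN (- y) sp; rewrite opprK.
  rewrite -{1}(tiltp y) (le_trans (tilt_le _ _ sp ler01))//.
  by rewrite rmorph1 scale1r addNr mul1r sublinear0// sub0r.
exists p; split=> // [x y|t x].
  apply/le_anti; rewrite sp.1/=; have := sp.1 (- x) (- y).
  by rewrite -opprD !pN; lra.
have [t0|t0] := leP 0 t; first exact: sublinearZ.
have {}t0 : 0 <= - t by lra.
by rewrite -[t]opprK rmorphN scaleNr pN sublinearZ//; ring.
Qed.

(** Any linear function below the tilt of q along x0 is below q and attains q at
    x0. *)
Lemma sublinear_norming q x0 : sublinear q -> exists f : E -> R,
  [/\ forall x y, f (x + y) = f x + f y, forall t x, f (iota t *: x) = t * f x,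
      forall x, f x <= q x & f x0 = q x0].
Proof.
move=> sq; have [f [fD fZ fq]] := sublinear_ge_linear (tilt_sublinear x0 sq).
have {}fq' x : f x <= q x by apply: le_trans (fq x) (tilt_le_self _ _ sq).
exists f; split=> //; apply/le_anti; rewrite fq'/=.
have := le_trans (fq (- x0)) (tilt_le _ _ sq ler01).
have := fZ (-1) x0; rewrite rmorphN rmorph1 !scaleN1r scale1r => ->.
by rewrite addNr sublinear0//; lra.
Qed.
End HahnBanach.

Section Norming.
Context {R : realType}.

Lemma real_norming (E : normedModType R) (x0 : E) :
  exists f : E -> R^o, [/\ linear f, forall x, `|f x| <= `|x| & `|f x0| = `|x0|].
Proof.
have sN : sublinear (@idfun R) (fun x : E => `|x|).
  split=> [x y|t x t0]; first exact: ler_normD.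
  by rewrite normrZ ger0_norm.
have [f [fD fZ fN fx0]] := sublinear_norming x0 sN.
have fZ' t x : f (t *: x) = t * f x := fZ t x.
exists f; split=> [t x y|x|]; [by rewrite fD fZ' | | by rewrite fx0 normr_id].
rewrite ler_norml fN andbT; have := fN (- x).
by rewrite -scaleN1r fZ' normrZ normrN normr1; lra.
Qed.

(** The real part of a complex functional determines it, as
    g x = f x - i f (i x), and a rotation of x makes g x real, which bounds |g x|
    by the bound on f. *)
Lemma complex_norming (E : normedModType R[i]) (x0 : E) :
  exists f : E -> R[i]^o, [/\ linear f, forall x, `|f x| <= `|x| & `|f x0| = `|x0|].
Proof.
pose N (x : E) := complex.Re `|x|.
have NE x : `|x| = (N x)%:C%C.
  by have := normr_ge0 x; rewrite /N; case: `|x| => a b; rewrite lecE /= => /andP[/eqP->].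
have sN : sublinear (real_complex R) N.
  split=> [x y|t x t0]; first by have := ler_normD x y; rewrite !NE -rmorphD lecR.
  by rewrite {1}/N normrZ ger0_norm ?lecR// NE -rmorphM.
have [f [fD fZ fN fx0]] := sublinear_norming x0 sN.
have fNN x : f (- x) = - f x.
  by have := fZ (-1) x; rewrite rmorphN1 scaleN1r mulN1r.
pose g (x : E) : R[i]^o := (f x)%:C%C - 'i%C * (f ('i%C *: x))%:C%C.
have gD x y : g (x + y) = g x + g y.
  by rewrite /g scalerDr !fD !rmorphD/=; ring.
have gR t x : g (t%:C%C *: x) = t%:C%C * g x.
  rewrite /g; have -> : 'i%C *: (t%:C%C *: x) = t%:C%C *: ('i%C *: x) by rewrite !scalerA mulrC.
  by rewrite !fZ !rmorphM/=; ring.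
have gI x : g ('i%C *: x) = 'i%C * g x.
  rewrite /g scalerA -expr2 sqr_i scaleN1r fNN rmorphN /=.
  set a := (f _)%:C%C; set b := (f _)%:C%C.
  have i2 : 'i%C * 'i%C = -1 :> R[i] by rewrite -expr2 sqr_i.
  rewrite mulrBr mulrA i2; ring.
have gZ c x : g (c *: x) = c * g x.
  rewrite (complexE c) scalerDl -scalerA gD gR gI gR; ring.
have gRe x : complex.Re (g x) = f x.
  by rewrite /g; simpc.
have gN x : `|g x| <= `|x|.
  have [->|gx0] := eqVneq (g x) 0; first by rewrite normr0.
  pose u := `|g x| / g x.
  have u1 : `|u| = 1 by rewrite normf_div normr_id divff// normr_eq0.
  have -> : `|g x| = g (u *: x) by rewrite gZ divfK.
  have -> : `|x| = `|u *: x| by rewrite normrZ u1 mul1r.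
  have : 0 <= g (u *: x) by rewrite gZ divfK.
  rewrite NE lecE => /andP[/eqP im0 _]; rewrite lecE im0.
  by have := fN (u *: x); rewrite -gRe /= eqxx.
exists g; split=> // [c x y|]; first by rewrite gD gZ.
apply/le_anti/andP; split; first exact: gN.
have N0 : 0 <= N x0 by have := normr_ge0 x0; rewrite NE -(rmorph0 (real_complex R)) lecR.
by have := normc_ge_Re (g x0); rewrite gRe fx0 ger0_norm// -NE.
Qed.
End Norming.

(** * Compactness in the scalar field and in dual balls *)

Section Scalars.
Context {R : realType}.

Lemma real_bounded_in_compact (M : R) :
  exists2 A : set R^o, compact A & [set c : R^o | `|c| <= M] `<=` A.
Proof.
exists (`[- M, M]%classic : set R); first exact: segment_compact.
by move=> c /=; rewrite in_itv /= ler_norml.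
Qed.

Lemma complex_bounded_in_compact (M : R[i]) :
  exists2 A : set R[i]^o, compact A & [set c : R[i]^o | `|c| <= M] `<=` A.
Proof.
pose f (p : R * R) : R[i]^o := p.1%:C%C + 'i%C * p.2%:C%C.
have nR (a : R) : `|a%:C%C| = `|a|%:C%C :> R[i].
  by rewrite normc_def /= expr0n /= addr0 sqrtr_sqr.
have nI : `|'i%C| = 1 :> R[i].
  by rewrite normc_def /= expr0n /= add0r expr1n sqrtr1.
have fle p q : `|f p - f q| <= (`|p.1 - q.1| + `|p.2 - q.2|)%:C%C.
  have -> : f p - f q = (p.1 - q.1)%:C%C + 'i%C * (p.2 - q.2)%:C%C.
    by rewrite /f !rmorphB /=; ring.
  apply: le_trans (ler_normD _ _) _.
  by rewrite normrM nI mul1r !nR -rmorphD lexx.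
have fcont : continuous f.
  move=> p; apply/cvgrPdist_lt => e e0.
  have eE : e = (complex.Re e)%:C%C.
    by move: e0; case: e => a b; rewrite ltcE /= => /andP[/eqP ->].
  have r0 : 0 < complex.Re e / 2.
    by move: e0; rewrite eE -(rmorph0 (real_complex R)) ltcR => ?; rewrite divr_gt0.
  near=> q; rewrite (le_lt_trans (fle p q))// eE ltcR.
  rewrite [ltRHS](splitr (complex.Re e)) ltrD//.
    near: q; have /cvgrPdist_lt : (fst : R * R -> R) q @[q --> p] --> p.1 by exact: cvg_fst.
    exact.
  near: q; have /cvgrPdist_lt : (snd : R * R -> R) q @[q --> p] --> p.2 by exact: cvg_snd.
  exact.
pose N := complex.Re M.
exists (f @` (`[- N, N] `*` `[- N, N])).
  apply: continuous_compact; first exact: continuous_subspaceT.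
  by apply: compact_setX; exact: segment_compact.
move=> c /= cM.
have RleN (d : R[i]) : `|d| <= M -> `|complex.Re d| <= N.
  by move=> dM; have := le_trans (normc_ge_Re d) dM; rewrite lecE /= => /andP[].
have aN := RleN c cM.
have bN : `|complex.Im c| <= N.
  have := RleN ('i%C * c); rewrite normrM nI mul1r => /(_ cM).
  by case: c {cM aN} => a b; simpc; rewrite normrN.
exists (complex.Re c, complex.Im c); last by rewrite /f /= -complexE.
by split; rewrite /= in_itv /= -ler_norml.
Unshelve. all: by end_near. Qed.
End Scalars.

Section ScalarField.
Context {R : realType} {k : scalar_kind}.
Local Notation K := (scalars R k).

Lemma scalars_bounded_in_compact (M : K) :
  exists2 A : set K^o, compact A & [set c : K^o | `|c| <= M] `<=` A.
Proof.
by case: k M => M; [exact: real_bounded_in_compact | exact: complex_bounded_in_compact].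
Qed.

Lemma scalars_complete (F : set_system K^o) : ProperFilter F -> cauchy F -> cvg F.
Proof.
move=> FF Fc.
have /cauchy_ballP/(_ 1 ltr01)[[A B] /= [FA FB] AB] := Fc.
have [c Ac] := filter_ex FA.
have [C cC sC] := scalars_bounded_in_compact (`|c| + 1).
apply: (@compact_cauchy_cvg K^o C F) => //; apply: filterS FB => d Bd; apply: sC => /=.
have /ltW := AB (c, d) (conj Ac Bd); rewrite -[in X in X -> _]normrN opprB => cd.
by rewrite -[d](subrK c) addrC (le_trans (ler_normD _ _))// lerD2l.
Qed.

Lemma ultra_fmap (S T : Type) (f : S -> T) (U : set_system S) :
  UltraFilter U -> UltraFilter (fmap f U).
Proof.
move=> UU; have fU : ProperFilter (fmap f U) by exact: fmap_proper_filter.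
split=> // G GG UG; apply/seteqP; split=> [A GA|]; last exact: UG.
have [//|UnA] := in_ultra_setVsetC (f @^-1` A) UU.
by have [x [Ax nAx]] := filter_ex (filterI GA (UG (~` A) UnA)).
Qed.

Lemma ultra_bounded_cvg (I : Type) (U : set_system I) (f : I -> K^o) (M : K) :
  UltraFilter U -> (forall i, `|f i| <= M) -> cvg (f @ U).
Proof.
move=> UU fM; have [C cC sC] := scalars_bounded_in_compact M.
have fUC : (f @ U) C by apply: (@filterE _ U _ _) => i; apply: sC; exact: fM.
have UfU : UltraFilter (f @ U) by exact: ultra_fmap.
rewrite compact_ultra in cC; have [c [_ fc]] := cC (f @ U) UfU fUC.
exact: cvgP fc.
Qed.

Lemma cvg_norm_le (T : Type) (F : set_system T) (V : normedModType K) (f : T -> V) l (M : K) :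
  ProperFilter F -> f @ F --> l -> (\forall x \near F, `|f x| <= M) -> `|l| <= M.
Proof.
move=> FF fl fM; apply/ler_addgt0Pr => e e0.
have /cvgrPdist_lt/(_ e e0) fe := fl.
have [x [fx1 fx2]] := filter_ex (filterI fM fe).
by rewrite -[l](subrK (f x)) addrC (le_trans (ler_normD _ _))// lerD// ltW.
Qed.

Section Operators.
Context {E F : normedModType K}.

Definition mk_operator (f : E -> F) (lf : linear f) (M : K) (fM : forall x, `|f x| <= M * `|x|) :
  operator E F := Operator (asboolT (conj lf (ex_intro _ M fM))).

HB.instance Definition _ (T : operator E F) :=
  GRing.isLinear.Build K E F _ (operator_fun T) (operator_linear T).

Lemma operator_norm_le (T : operator E F) (M : K) : 0 <= M -> (forall x, `|T x| <= M * `|x|) -> `|T| <= M.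
Proof.
move=> M0 TM; apply: op_norm_le => x x1; apply: le_trans (TM x) _.
by rewrite ler_piMr.
Qed.

Lemma operator_le (T : operator E F) x : `|T x| <= `|T| * `|x|.
Proof. exact: le_op_norm. Qed.

Lemma operator_continuous (T : operator E F) : continuous T.
Proof.
move=> x; apply/cvgrPdist_lt => e e0.
have T1 : 0 < `|T| + 1 by rewrite ltr_wpDl.
near=> y; rewrite -raddfB; apply: le_lt_trans (operator_le _ _) _.
apply: (@le_lt_trans _ _ ((`|T| + 1) * `|x - y|)); first by rewrite ler_wpM2r// lerDl.
rewrite mulrC -ltr_pdivlMr//; near: y; apply: cvgr_dist_lt; first exact: cvg_id.
by rewrite divr_gt0.
Unshelve. all: by end_near. Qed.
End Operators.

Lemma norming_functional (E : normedModType K) (x0 : E) :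
  exists phi : dual E, `|phi| <= 1 /\ `|phi x0| = `|x0|.
Proof.
have [f [lf fN fx0]] : exists f : E -> K^o,
    [/\ linear f, forall x, `|f x| <= `|x| & `|f x0| = `|x0|].
  by move: E x0; case: k => E x0; [exact: real_norming | exact: complex_norming].
have f1 x : `|f x| <= 1 * `|x| by rewrite mul1r.
by exists (mk_operator lf f1); split=> //; exact: operator_norm_le.
Qed.

(** The Banach-Alaoglu theorem, in the form in which it is used: along an
    ultrafilter, functionals in the unit ball converge pointwise to one of them. *)
Lemma ultra_dual_cvg (E : normedModType K) (I : Type) (U : set_system I) (f : I -> dual E) :
  UltraFilter U -> (forall i, `|f i| <= 1) ->
  exists phi : dual E, `|phi| <= 1 /\ forall x, f i x @[i --> U] --> phi x.
Proof.
move=> UU f1.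
have fM x i : `|f i x| <= `|x|.
  by apply: le_trans (operator_le _ _) _; rewrite ler_piMl.
pose g x : K^o := lim (f i x @[i --> U]).
have fg x : f i x @[i --> U] --> g x by apply: ultra_bounded_cvg; exact: fM.
have lg : linear g.
  move=> a x y; have : a *: f i x + f i y @[i --> U] --> a *: g x + g y.
    by apply: cvgD (fg y); exact: cvgZl_tmp (fg x).
  have -> : (fun i => a *: f i x + f i y) = (fun i => f i (a *: x + y)).
    by apply/funext => i; rewrite linearP.
  by apply: cvg_unique (fg _); exact: norm_hausdorff.
have gM x : `|g x| <= 1 * `|x|.
  by rewrite mul1r; apply: (cvg_norm_le _ (fg x)); near=> i; exact: fM.
exists (mk_operator lg gM); split=> //; exact: operator_norm_le.
Unshelve. all: by end_near. Qed.
End ScalarField.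

(** * Operators and weak topologies *)

Section OperatorCalculus.
Context {R : realType} {k : scalar_kind}.
Local Notation K := (scalars R k).

Section Comp.
Context {E F H : normedModType K}.
Variables (S : operator F H) (T : operator E F).
Lemma comp_linear : linear (S \o T).
Proof. by move=> a x y; rewrite /= !linearP. Qed.
Lemma comp_bound x : `|(S \o T) x| <= `|S| * `|T| * `|x|.
Proof.
rewrite -mulrA; apply: le_trans (operator_le _ _) _.
by rewrite ler_wpM2l// operator_le.
Qed.
Definition comp_operator : operator E H := mk_operator comp_linear comp_bound.
End Comp.

Section Eval.
Context {E : normedModType K}.
Variable x : E.
Lemma eval_linear : linear (fun phi : dual E => phi x : K^o).
Proof. by []. Qed.
Lemma eval_bound (phi : dual E) : `|phi x| <= `|x| * `|phi|.
Proof. by rewrite mulrC; exact: operator_le. Qed.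
Definition eval_operator : bidual E := mk_operator eval_linear eval_bound.
Lemma eval_operator_norm : `|eval_operator| <= `|x|.
Proof. by apply: operator_norm_le => // phi; exact: eval_bound. Qed.
End Eval.

Lemma weakly_null_operator (E F : normedModType K) (T : operator E F) (x : nat -> E) :
  weakly_converges x 0 -> weakly_converges (T \o x) 0.
Proof.
by move=> x0 phi; have := x0 (comp_operator phi T); rewrite /= !linear0.
Qed.

(** The images form a norm Cauchy sequence that is also weakly null. Norming
    T (x n) by a functional and letting m tend to infinity in
    |T (x n) - T (x m)| bounds |T (x n)|; no limit has to exist in F. *)
Lemma completely_continuous_weakly_null (E F : normedModType K) (T : operator E F) (x : nat -> E) :
  completely_continuous T -> weakly_converges x 0 -> T (x n) @[n --> \oo] --> 0.
Proof.
move=> Tcc x0.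
have /Tcc/cauchy_ballP Tx : weakly_cauchy x.
  by move=> phi; apply: cvg_cauchy; apply: cvgP (x0 phi).
have Tx0 := weakly_null_operator T x0.
apply/cvgr0Pnorm_lt => e e0.
have e2 : 0 < e / 2 by rewrite divr_gt0.
have [[A B] /= [nA nB] AB] := Tx _ e2.
near=> n; apply: (@le_lt_trans _ _ (e / 2)); last first.
  by rewrite ltr_pdivrMr// ltr_pMr// ltr1n.
have [phi [phi1 <-]] := norming_functional (T (x n)).
have : phi (T (x n)) - phi (T (x m)) @[m --> \oo] --> phi (T (x n)) - phi 0.
  by apply: cvgB; [exact: cvg_cst | exact: Tx0].
rewrite linear0 subr0 => cphi; apply: (cvg_norm_le _ cphi).
near=> m; rewrite -raddfB (le_trans (operator_le _ _))//.
apply: (@le_trans _ _ (`|T (x n) - T (x m)|)); first by rewrite ler_piMl.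
suff AT : A (T (x n)) /\ B (T (x m)).
  have := AB (T (x n), T (x m)) AT.
  by rewrite -ball_normE; exact: ltW.
by split; [near: n | near: m].
Unshelve. all: by end_near. Qed.

Lemma weakly_cvg_filter (E : normedModType K) (U : set_system E) (l : E) :
  Filter U -> (forall phi : dual E, phi x @[x --> U] --> phi l) ->
  (U : set_system (weak E)) --> (l : weak E).
Proof.
move=> UU xl.
pose ev : weak E -> {ptws dual E -> K^o} := fun x phi => phi x.
have evxl : ev @ U --> ev l.
  by apply/(@pointwise_cvgP _ K^o (ev @ U) (ev l)) => phi; exact: xl.
move=> V; rewrite nbhsE => -[_ [[W Wo <-] Wl] WV].
have /evxl : nbhs (ev l) W by exact: open_nbhs_nbhs.
move=> UW; apply: (@filterS _ U UU (ev @^-1` W)); last exact: UW.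
by move=> x; exact: WV.
Qed.

Lemma weak_continuous (E : normedModType K) (phi : dual E) :
  continuous (fun x : weak E => phi x : K^o).
Proof.
move=> x.
pose ev : weak E -> {ptws dual E -> K^o} := fun x phi => phi x.
have ev_cont : ev @ nbhs x --> ev x by apply: initial_continuous.
by move/(@pointwise_cvgP _ K^o (ev @ nbhs x) (ev x))/(_ phi) : ev_cont.
Qed.

Lemma weak_hausdorff (E : normedModType K) :
  hausdorff_space (weak E).
Proof.
move=> p q pq; apply/eqP; rewrite -subr_eq0 -normr_eq0.
have [phi [_ <-]] := norming_functional (p - q : E).
rewrite normr_eq0 raddfB subr_eq0; apply/eqP.
apply: (@norm_hausdorff K K^o) => A B nA nB.
have [x [Ax Bx]] := pq _ _ (weak_continuous nA) (weak_continuous nB).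
by exists (phi x).
Qed.
End OperatorCalculus.

(** * The Banach space c0 *)

Section C0.
Context {R : realType} {k : scalar_kind}.
Local Notation K := (scalars R k).

Definition null_sequences : {pred nat -> K^o} :=
  fun w => `[< w n @[n --> \oo] --> 0 >].

Record c0 := C0 { c0_fun :> nat -> K^o ; c0P : c0_fun \in null_sequences }.

HB.instance Definition _ := [isSub for c0_fun].
HB.instance Definition _ := gen_eqMixin c0.
HB.instance Definition _ := gen_choiceMixin c0.

Lemma null_sequences_submod : submod_closed null_sequences.
Proof.
split; first by apply/asboolP; exact: cvg_cst.
move=> a f g /asboolP f0 /asboolP g0; apply/asboolP.
have : a *: f n + g n @[n --> \oo] --> a *: 0 + 0 by apply: cvgD g0; exact: cvgZl_tmp f0.
by rewrite scaler0 addr0.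
Qed.

HB.instance Definition _ :=
  GRing.isSubmodClosed.Build K (nat -> K^o) null_sequences null_sequences_submod.
HB.instance Definition _ := [SubChoice_isSubLmodule of c0 by <:].

Lemma c0_cvg (w : c0) : w n @[n --> \oo] --> 0.
Proof. exact: asboolW (c0P w). Qed.

Definition c0_norm (w : c0) : K := supremum 0 (range (fun n => `|w n|)).

Lemma c0_bounded (w : c0) : exists M : K, forall n, `|w n| <= M.
Proof.
have /cvgr0Pnorm_lt/(_ 1 ltr01)[N _ wN] := c0_cvg w.
exists (1 + \sum_(i < N) `|w i|) => n; have [Nn|nN] := leqP N n.
  by rewrite (le_trans (ltW (wN n Nn)))// lerDl sumr_ge0.
by rewrite (bigD1 (Ordinal nN))//= addrCA lerDl addr_ge0// sumr_ge0.
Qed.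

Lemma c0_norm_supremums (w : c0) : supremums (range (fun n => `|w n|)) (c0_norm w).
Proof.
rewrite /c0_norm /supremum; case: ifPn => [/eqP S0|/set0P Sn0].
  have : range (fun n => `|w n|) `|w 0%N| by exists 0%N.
  by rewrite S0.
have [s] : supremums (range (fun n => `|w n|)) !=set0.
  have [M wM] := c0_bounded w.
  by apply: (@scalars_supremums R k _ M) => // _ [n _ <-]; rewrite normr_ge0 /=.
exact: xgetI.
Qed.

Lemma le_c0_norm (w : c0) n : `|w n| <= c0_norm w.
Proof. by have [+ _] := c0_norm_supremums w; apply; exists n. Qed.

Lemma c0_norm_le (w : c0) M : (forall n, `|w n| <= M) -> c0_norm w <= M.
Proof. by move=> wM; have [_] := c0_norm_supremums w; apply=> _ [n _ <-]. Qed.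

Lemma c0_normD (v w : c0) : c0_norm (v + w) <= c0_norm v + c0_norm w.
Proof.
apply: c0_norm_le => n; rewrite (_ : (v + w) n = v n + w n)//.
by rewrite (le_trans (ler_normD _ _))// lerD// le_c0_norm.
Qed.

Lemma c0_normZ (a : K) (w : c0) : c0_norm (a *: w) = `|a| * c0_norm w.
Proof.
have le_normZ (b : K) (v : c0) : c0_norm (b *: v) <= `|b| * c0_norm v.
  apply: c0_norm_le => n; rewrite (_ : (b *: v) n = b *: v n)// normrZ.
  by rewrite ler_wpM2l// le_c0_norm.
have c0_ge0 (v : c0) : 0 <= c0_norm v by apply: le_trans (le_c0_norm v 0).
apply/le_anti; rewrite le_normZ /=.
have [->|a0] := eqVneq a 0; first by rewrite normr0 mul0r.
have := le_normZ a^-1 (a *: w); rewrite scalerA mulVf// scale1r normfV.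
by rewrite ler_pdivlMl// normr_gt0.
Qed.

Lemma c0_norm_eq0 (w : c0) : c0_norm w = 0 -> w = 0.
Proof.
move=> w0; apply: val_inj; apply/funext => n /=.
by apply/eqP; rewrite -normr_le0 -w0 le_c0_norm.
Qed.

HB.instance Definition _ :=
  Lmodule_isNormed.Build K c0 c0_normD c0_normZ c0_norm_eq0.

Lemma c0_coord_le (w : c0) n : `|w n| <= `|w|.
Proof. exact: le_c0_norm. Qed.

Lemma c0_le (w : c0) M : (forall n, `|w n| <= M) -> `|w| <= M.
Proof. exact: c0_norm_le. Qed.

Lemma c0B (v w : c0) n : (v - w) n = v n - w n.
Proof. by []. Qed.

(** The pointwise limit of a Cauchy filter is uniform, and a uniform limit of null
    sequences is null. *)
Lemma c0_complete (F : set_system c0) : ProperFilter F -> cauchy F -> cvg F.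
Proof.
move=> FF /cauchyP Fc.
have coordF e : 0 < e -> exists w0 : c0, \forall w \near F, `|w0 - w| < e.
  by move=> e0; have [w0 w0F] := Fc e e0; exists w0; move: w0F; rewrite -ball_normE.
pose l n : K^o := lim ((w : c0) n @[w --> F]).
have Fl n : (w : c0) n @[w --> F] --> l n.
  apply: scalars_complete; apply/cauchyP => e e0.
  have [w0 w0F] := coordF e e0; exists (w0 n); rewrite -ball_normE.
  apply: filterS w0F => w /=; apply: le_lt_trans.
  by rewrite -c0B c0_coord_le.
have near_l e : 0 < e -> exists w0 : c0,
    (\forall w \near F, `|w0 - w| < e) /\ forall n, `|w0 n - l n| <= e.
  move=> e0; have [w0 w0F] := coordF e e0; exists w0; split=> // n.
  have : w0 n - (w : c0) n @[w --> F] --> w0 n - l n by apply: cvgB; [exact: cvg_cst | exact: Fl].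
  move/cvg_norm_le; apply; apply: filterS w0F => w /ltW; apply: le_trans.
  by rewrite -c0B c0_coord_le.
have l0 : l \in null_sequences.
  apply/asboolP/cvgr0Pnorm_lt => e e0.
  have e2 : 0 < e / 2 by rewrite divr_gt0.
  have [w0 [_ w0l]] := near_l _ e2.
  have /cvgr0Pnorm_lt/(_ _ e2) := c0_cvg w0; apply: filterS => n w0n.
  rewrite [l n](_ : _ = w0 n - (w0 n - l n)); last by rewrite subKr.
  by rewrite (le_lt_trans (ler_normB _ _))// [ltRHS](splitr e) ltr_leD.
apply/cvg_ex; exists (C0 l0); apply/cvgrPdist_lt => e e0.
have e3 : 0 < e / 2 / 2 by rewrite !divr_gt0.
have [w0 [w0F w0l]] := near_l _ e3; apply: filterS w0F => w w0w.
apply: (@le_lt_trans _ _ (e / 2)).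
  apply: c0_le => n; rewrite c0B /= -[l n](subKr (w0 n)) -addrA [- _ + _]addrC addrA.
  rewrite (le_trans (ler_normB _ _))// [leRHS](splitr (e / 2)) lerD//.
  by rewrite -c0B (le_trans (c0_coord_le _ _))// ltW.
by rewrite ltr_pdivrMr// ltr_pMr// ltr1n.
Qed.

HB.instance Definition _ := Uniform_isComplete.Build c0 c0_complete.

Definition c0_banach : completeNormedModType K := c0.

End C0.
Arguments c0 : clear implicits.
Arguments c0_banach : clear implicits.

(** * The dual of c0 *)

Section C0Dual.
Context {R : realType} {k : scalar_kind}.
Local Notation K := (scalars R k).
Local Notation c0 := (c0 R k).
Implicit Types (v w : c0) (a : dual c0).

Lemma c0D v w n : (v + w) n = v n + w n. Proof. by []. Qed.
Lemma c0Z (c : K) w n : (c *: w) n = c * w n. Proof. by []. Qed.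
Lemma c0_sum (I : Type) (r : seq I) (w : I -> c0) n :
  (\sum_(i <- r) w i) n = \sum_(i <- r) w i n.
Proof. by apply: (big_morph (fun w : c0 => w n)). Qed.

Lemma c0_unit_null i : (fun n => (n == i)%:R : K^o) \in null_sequences.
Proof.
apply/asboolP; apply: cvg_near_cst; near=> n.
suff /gtn_eqF -> : (i < n)%N by [].
by near: n; exact: nbhs_infty_gt.
Unshelve. all: by end_near. Qed.
Definition c0_unit i : c0 := C0 (c0_unit_null i).

Definition c0_trunc N w : c0 := \sum_(i < N) w i *: c0_unit i.

Lemma c0_truncE N w n : c0_trunc N w n = if (n < N)%N then w n else 0.
Proof.
rewrite c0_sum; under eq_bigr do rewrite c0Z.
case: ltnP => nN.
  rewrite (bigD1 (Ordinal nN))//= eqxx mulr1 big1 ?addr0// => i /eqP ni.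
  by rewrite (_ : (n == i) = false) ?mulr0//; apply/eqP => ?; apply: ni; exact: val_inj.
by rewrite big1// => i _; rewrite /= gtn_eqF ?mulr0//; apply: leq_trans nN.
Qed.

Lemma c0_trunc_cvg w : c0_trunc N w @[N --> \oo] --> w.
Proof.
apply/cvgrPdist_le => e e0.
have /cvgr0Pnorm_lt/(_ _ e0)[N0 _ wN] := c0_cvg w.
near=> N; apply: c0_le => n; rewrite c0B c0_truncE; case: ltnP => nN.
  by rewrite subrr normr0 ltW.
rewrite subr0 ltW//; apply: wN => /=; apply: leq_trans nN.
by near: N; exact: nbhs_infty_ge.
Unshelve. all: by end_near. Qed.

Lemma rotation (c : K) : exists u : K, `|u| = 1 /\ u * c = `|c|.
Proof.
have [->|c0] := eqVneq c 0; first by exists 1; rewrite normr1 mulr0 normr0.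
by exists (`|c| / c); rewrite divfK// normf_div normr_id divff// normr_eq0.
Qed.

(** This replaces the identification of the dual of c0 with l1. Vectors with
    disjoint supports p and q can be rotated so that |a p| and |a q| add up
    without increasing the norm; so once a nearly attains its norm on finitely
    many coordinates, it is small on the others. *)
Lemma c0_dual_tail a (e : K) : 0 < e -> \forall M \near \oo,
  forall v, `|v| <= 1 -> `|a (v - c0_trunc M v)| <= e.
Proof.
move=> e0.
have [w w1 aw] : exists2 w, `|w| <= 1 & `|a| - e < `|a w|.
  apply: contrapT => /forall2NP aw.
  have : `|a| <= `|a| - e.
    apply: op_norm_le => w w1; have [//|] := aw w.
    by move/negP; rewrite -real_leNgt// ?realB// gtr0_real.
  by rewrite lerBrDr gerDl => /(lt_le_trans e0); rewrite ltxx.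
have : `|a (c0_trunc N w)| @[N --> \oo] --> `|a w|.
  apply: cvg_norm; apply: continuous_cvg; last exact: c0_trunc_cvg.
  exact: operator_continuous.
have d0 : 0 < `|a w| - (`|a| - e) by rewrite subr_gt0.
move/cvgrPdist_lt => /(_ _ d0) aN.
have [N aNw] : exists N, `|a| - e <= `|a (c0_trunc N w)|.
  have [N] := filter_ex aN; exists N.
  have : `|a w| - `|a (c0_trunc N w)| <= `|a w| - (`|a| - e).
    by apply: le_trans (ltW p); apply: real_ler_norm; rewrite realB.
  by rewrite lerD2l lerN2.
near=> M => v v1; set p := c0_trunc N w in aNw; set q := v - c0_trunc M v.
have NM : (N <= M)%N by near: M; exact: nbhs_infty_ge.
(* Unimodular s and t make both values of a nonnegative. *)
have [s [s1 sp]] := rotation (a p); have [t [t1 tq]] := rotation (a q).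
have pq1 : `|s *: p + t *: q| <= 1.
  apply: c0_le => n; rewrite c0D !c0Z /p /q c0B !c0_truncE.
  have [nN|nN] := ltnP n N.
    rewrite (leq_trans nN NM) subrr mulr0 addr0 normrM s1 mul1r.
    exact: le_trans (c0_coord_le _ _) w1.
  rewrite mulr0 add0r normrM t1 mul1r; case: ifP => _; first by rewrite subrr normr0.
  by rewrite subr0; exact: le_trans (c0_coord_le _ _) v1.
have apq : a (s *: p + t *: q) = `|a p| + `|a q|.
  by rewrite linearD !linearZ; congr (_ + _); [exact: sp | exact: tq].
have : `|a p| + `|a q| <= `|a|.
  rewrite -[leLHS]ger0_norm ?addr_ge0// -apq.
  by apply: le_trans (operator_le _ _) _; rewrite ler_piMr.
move=> h; have := lerB h aNw.
by rewrite opprB addrCA subrr addr0 addrAC subrr add0r.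
Unshelve. all: by end_near. Qed.
End C0Dual.

(** * The Dunford-Pettis property and weakly null functionals *)

Section Pairing.
Context {R : realType} {k : scalar_kind}.
Local Notation K := (scalars R k).
Variables (G : completeNormedModType K) (Phi : nat -> dual G).
Hypotheses (Phi0 : weakly_converges Phi 0) (Phi1 : forall n, `|Phi n| <= 1).

Lemma bidual_coord_null (z : bidual G) : (fun n => z (Phi n) : K^o) \in null_sequences.
Proof. by apply/asboolP; have := @Phi0 z; rewrite linear0. Qed.

(** The bitranspose of [to_c0]: it takes values in c0, and not only in the bidual
    of c0, because Phi is weakly null. *)
Definition bidual_to_c0 (z : bidual G) : c0 R k := C0 (@bidual_coord_null z).

Definition to_c0_fun (u : G) : c0 R k := bidual_to_c0 (eval_operator u).

Lemma to_c0_linear : linear to_c0_fun.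
Proof. by move=> c u v; apply: val_inj; apply/funext => n /=; rewrite linearP. Qed.

Lemma to_c0_bound u : `|to_c0_fun u| <= 1 * `|u|.
Proof.
rewrite mul1r; apply: c0_le => n /=; apply: le_trans (operator_le _ _) _.
by rewrite ler_piMl.
Qed.

Definition to_c0 : operator G (c0 R k) := mk_operator to_c0_linear to_c0_bound.

Lemma to_c0_norm : `|to_c0| <= 1.
Proof. by apply: operator_norm_le => // u; exact: to_c0_bound. Qed.

(** [bidual_to_c0] is continuous from the weak-star topology to the weak topology
    of c0. By [c0_dual_tail], the composite of a and [to_c0] is the norm limit of
    combinations of the Phi i, against which both sides agree. *)
Lemma dual_bidual_to_c0 (a : dual (c0 R k)) (z : bidual G) :
  a (bidual_to_c0 z) = z (comp_operator a to_c0 : dual G).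
Proof.
pose b N : dual G := \sum_(i < N) (a (c0_unit i) : K) *: Phi i.
have bE N (y : bidual G) : a (c0_trunc N (bidual_to_c0 y)) = y (b N).
  rewrite /c0_trunc /b !linear_sum; apply: eq_bigr => i _.
  by rewrite !linearZ /=; exact: mulrC.
have bcvg : b N @[N --> \oo] --> (comp_operator a to_c0 : dual G).
  apply/cvgrPdist_le => e e0; apply: filterS (c0_dual_tail a e0) => N aN.
  apply: op_norm_le => u u1.
  have -> : (comp_operator a to_c0 - b N : operator G K^o) u =
      a (to_c0 u - c0_trunc N (to_c0 u)).
    by rewrite raddfB /= (bE N (eval_operator u)).
  by apply: aN; rewrite (le_trans (operator_le _ _))// mulr_ile1// to_c0_norm.
have h1 : z (b N) @[N --> \oo] --> z (comp_operator a to_c0 : dual G).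
  by apply: continuous_cvg bcvg; exact: operator_continuous.
have h2 : z (b N) @[N --> \oo] --> a (bidual_to_c0 z).
  under eq_fun do rewrite -bE.
  apply: continuous_cvg; first exact: operator_continuous.
  exact: c0_trunc_cvg.
by apply: cvg_unique h2 h1; exact: norm_hausdorff.
Qed.

(** The image of the unit ball lies in the image of the bidual ball under
    [bidual_to_c0]. Any ultrafilter on the latter lifts to the bidual ball, where
    it converges pointwise by [ultra_dual_cvg]. *)
Lemma to_c0_weakly_compact : weakly_compact to_c0.
Proof.
pose A : set (weak (c0 R k)) := bidual_to_c0 @` [set z | `|z| <= 1].
apply: (@precompact_subset _ _ A).
  move=> _ [u /= u1 <-]; exists (eval_operator u) => //=.
  exact: le_trans (eval_operator_norm _) u1.
apply: compact_precompact; first exact: weak_hausdorff.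
rewrite compact_ultra => U UU UA.
have /choice[Z ZP] : forall w : weak (c0 R k), exists z : bidual G,
    `|z| <= 1 /\ (A w -> bidual_to_c0 z = w).
  move=> w; have [[z z1 zw]|nAw] := pselect (A w); first by exists z.
  by exists 0; rewrite normr0.
have [z [z1 Uz]] := ultra_dual_cvg UU (fun w => (ZP w).1).
exists (bidual_to_c0 z); split; first by exists z.
apply: weakly_cvg_filter => a; rewrite dual_bidual_to_c0.
apply: cvg_trans (Uz (comp_operator a to_c0)); apply: near_eq_cvg.
apply: filterS UA => w Aw; rewrite -dual_bidual_to_c0.
by rewrite (ZP w).2.
Qed.

Lemma dunford_pettis_pairing (u : nat -> G) :
  dunford_pettis_property G -> weakly_converges u 0 ->
  Phi n (u n) @[n --> \oo] --> 0.
Proof.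
move=> GDP u0.
have Tcc := GDP (c0_banach R k) to_c0 to_c0_weakly_compact.
have Tu : to_c0 (u n) @[n --> \oo] --> 0 by exact: completely_continuous_weakly_null Tcc u0.
apply/cvgr0Pnorm_lt => e e0; move/cvgr0Pnorm_lt/(_ _ e0): Tu.
by apply: filterS => n; apply: le_lt_trans; exact: (c0_coord_le (to_c0 (u n)) n).
Qed.
End Pairing.

(** * Weakly null sequences of unit vectors *)

Section RealScalars.
Context {R : realType} {k : scalar_kind}.
Local Notation K := (scalars R k).

Definition real_scalar : R -> K :=
  match k with RealScalars => fun r => r | ComplexScalars => real_complex R end.

Definition real_part : K -> R :=
  match k with RealScalars => fun c => c | ComplexScalars => @complex.Re R end.

Lemma real_scalar_zmod_morphism : zmod_morphism real_scalar.
Proof. by rewrite /real_scalar; case: k => // r s; rewrite rmorphB. Qed.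
Lemma real_scalar_monoid_morphism : monoid_morphism real_scalar.
Proof.
by rewrite /real_scalar; case: k; split=> // r s; rewrite rmorphM.
Qed.
HB.instance Definition _ := GRing.isZmodMorphism.Build R K real_scalar real_scalar_zmod_morphism.
HB.instance Definition _ := GRing.isMonoidMorphism.Build R K real_scalar real_scalar_monoid_morphism.

Lemma ler_real_scalar r s : (real_scalar r <= real_scalar s) = (r <= s).
Proof. by rewrite /real_scalar; case: k => //; exact: lecR. Qed.

Lemma real_partK (c : K) : 0 <= c -> real_scalar (real_part c) = c.
Proof.
rewrite /real_scalar /real_part; case: k c => //= -[a b].
by rewrite lecE /= => /andP[/eqP ->].
Qed.

Lemma real_scalar_ge0 r : (0 <= real_scalar r) = (0 <= r).
Proof. by rewrite -(rmorph0 real_scalar) ler_real_scalar. Qed.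
Lemma real_scalar_le1 r : (real_scalar r <= 1) = (r <= 1).
Proof. by rewrite -(rmorph1 real_scalar) ler_real_scalar. Qed.

Lemma cvg_ge (T : Type) (F : set_system T) (f : T -> K^o) (l M : K) :
  ProperFilter F -> f @ F --> l -> (\forall x \near F, M <= f x) -> M <= l.
Proof.
move=> FF fl fM; rewrite -subr_ge0.
have h : f x - M @[x --> F] --> (l - M : K^o) by apply: cvgB => //; exact: cvg_cst.
have h1 : `|f x - M| @[x --> F] --> (`|l - M| : K^o) by exact: cvg_norm.
have h2 : f x - M @[x --> F] --> (`|l - M| : K^o).
  apply: cvg_trans h1; apply: near_eq_cvg; apply: filterS fM => x ?.
  by rewrite ger0_norm// subr_ge0.
by rewrite (@cvg_unique K^o (@norm_hausdorff _ _) _ _ _ _ h h2).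
Qed.

Lemma not_cvg0_subsequence (V : normedModType K) (f : nat -> V) :
  ~ (f n @[n --> \oo] --> 0) ->
  exists e : K, 0 < e /\ exists sigma : nat -> nat,
    (forall n, (n <= sigma n)%N) /\ forall n, e <= `|f (sigma n)|.
Proof.
move=> nf; apply: contrapT => H; apply: nf; apply/cvgr0Pnorm_lt => e e0.
apply: contrapT => ne; apply: H; exists e; split=> //.
have /choice[sigma sP] : forall n, exists m, (n <= m)%N /\ e <= `|f m|.
  move=> n; apply: contrapT => nm; apply: ne; exists n => // m /= nm'.
  rewrite real_ltNge ?normr_real ?gtr0_real//; apply/negP => em.
  by apply: nm; exists m.
by exists sigma; split=> n; have [] := sP n.
Qed.

Lemma weakly_null_reindex (E : normedModType K) (x : nat -> E) (sigma : nat -> nat) :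
  (forall n, (n <= sigma n)%N) -> weakly_converges x 0 ->
  weakly_converges (x \o sigma) 0.
Proof.
move=> sn x0 phi; have := x0 phi; apply: cvg_trans => A [N _ NA].
exists N => // n /= Nn; apply: NA => /=; exact: leq_trans (sn n).
Qed.

(** Normalising only the vectors of norm at least e > 0 keeps the sequence weakly
    null, and makes it bounded without the uniform boundedness principle. *)
Lemma weakly_null_norm1 (E : normedModType K) : ~ schur_property E ->
  exists x : nat -> E, (forall n, `|x n| = 1) /\ weakly_converges x 0.
Proof.
move=> /existsNP[x /not_implyP[[l xl] ncx]].
pose v n := x n - l.
have v0 : weakly_converges v 0.
  move=> phi; rewrite linear0 -(subrr (phi l)) /v.
  under eq_fun do rewrite raddfB.
  by apply: cvgB; [exact: xl | exact: cvg_cst].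
have nv : ~ (v n @[n --> \oo] --> 0).
  move=> h; apply: ncx; apply/cvg_ex; exists l.
  have : v n + l @[n --> \oo] --> 0 + l by apply: cvgD h _; exact: cvg_cst.
  by rewrite add0r; under eq_fun do rewrite /v subrK.
have [e [e0 [sigma [sn ve]]]] := not_cvg0_subsequence nv.
have vpos n : 0 < `|v (sigma n)| by apply: lt_le_trans (ve n).
exists (fun n => `|v (sigma n)|^-1 *: v (sigma n)); split=> [n|phi].
  by rewrite normrZ normfV normr_id mulVf// gt_eqF.
rewrite linear0; apply/cvgr0Pnorm_lt => d d0.
have : phi (v (sigma n)) @[n --> \oo] --> 0.
  by have := weakly_null_reindex sn v0 (phi := phi); rewrite linear0.
move/cvgr0Pnorm_lt/(_ (d * e)); rewrite mulr_gt0// => /(_ isT).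
apply: filterS => n vn; rewrite linearZ normrZ normfV normr_id.
rewrite mulrC ltr_pdivrMr//; apply: lt_le_trans vn _.
by rewrite ler_pM2l.
Qed.
End RealScalars.

(** * Weakly null sequences of tensors *)

Section InjectiveNorm.
Context {R : realType} {k : scalar_kind}.
Local Notation K := (scalars R k).
Context {E F : normedModType K}.
Implicit Types (s : seq (E * F)).

Definition pairing (xi : dual E) (psi : dual F) s : K^o := \sum_(p <- s) xi p.1 * psi p.2.

Let values s := [set r | exists (phi : dual E) (psi : dual F),
    [/\ `|phi| <= 1, `|psi| <= 1 & r = `|\sum_(p <- s) phi p.1 * psi p.2| ]].

Lemma pairing_norm (xi : dual E) (psi : dual F) s :
  `|xi| <= 1 -> `|psi| <= 1 -> `|pairing xi psi s| <= \sum_(p <- s) `|p.1| * `|p.2|.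
Proof.
move=> xi1 psi1; apply: le_trans (ler_norm_sum _ _ _) _; apply: ler_sum => p _.
rewrite normrM ler_pM// (le_trans (operator_le _ _))//; by rewrite ler_piMl.
Qed.

Lemma injective_norm_supremums s : supremums (values s) (injective_norm s).
Proof.
have s0 : values s !=set0.
  by exists `|pairing 0 0 s|, 0, 0; split=> //; rewrite normr0.
rewrite /injective_norm /supremum; case: ifPn => [/eqP S0|_].
  by move: s0; rewrite /values S0 => -[].
have [r] : supremums (values s) !=set0.
  apply: (@scalars_supremums R k _ (\sum_(p <- s) `|p.1| * `|p.2|)) => // _ [xi [psi [xi1 psi1 ->]]].
  by rewrite normr_ge0; exact: pairing_norm.
exact: xgetI.
Qed.

Lemma injective_norm_le s (M : K) :
  (forall (xi : dual E) (psi : dual F), `|xi| <= 1 -> `|psi| <= 1 -> `|pairing xi psi s| <= M) ->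
  injective_norm s <= M.
Proof.
by move=> sM; have [_] := injective_norm_supremums s; apply=> _ [xi [psi [? ? ->]]]; exact: sM.
Qed.

Lemma pairing_le s (xi : dual E) (psi : dual F) :
  `|pairing xi psi s| <= `|xi| * `|psi| * injective_norm s.
Proof.
have [->|xi0] := eqVneq xi 0.
  by rewrite /pairing big1 ?normr0 ?mul0r// => p _; exact: mul0r.
have [->|psi0] := eqVneq psi 0.
  by rewrite /pairing big1 ?normr0 ?mulr0 ?mul0r// => p _; exact: mulr0.
have xip : 0 < `|xi| by rewrite normr_gt0.
have psip : 0 < `|psi| by rewrite normr_gt0.
have [+ _] := injective_norm_supremums s.
move=> /(_ `|pairing (`|xi|^-1 *: xi) (`|psi|^-1 *: psi) s|).
have -> : pairing (`|xi|^-1 *: xi) (`|psi|^-1 *: psi) s = (`|xi| * `|psi|)^-1 * pairing xi psi s.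
  rewrite /pairing mulr_sumr; apply: eq_bigr => p _.
  by rewrite invfM mulrACA.
rewrite normrM normfV normrM !normr_id => h.
rewrite -ler_pdivrMl ?mulr_gt0//; apply: h.
exists (`|xi|^-1 *: xi), (`|psi|^-1 *: psi).
rewrite !normrZ !normfV !normr_id !mulVf ?gt_eqF//; split=> //.
have <- : (`|xi| * `|psi|)^-1 * pairing xi psi s = \sum_(p <- s)
    (`|xi|^-1 *: xi : dual E) p.1 * (`|psi|^-1 *: psi : dual F) p.2.
  by rewrite /pairing mulr_sumr; apply: eq_bigr => p _; rewrite invfM mulrACA.
by rewrite normrM normfV normrM !normr_id.
Qed.
End InjectiveNorm.

Section TensorNull.
Context {R : realType} {k : scalar_kind}.
Local Notation K := (scalars R k).
Context {E F EF : completeNormedModType K} {tensor : {bilinear E -> F -> EF}}.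
Hypothesis tensorP : is_injective_tensor_product tensor.
Local Notation tau s := (\sum_(p <- s) tensor p.1 p.2).

Lemma tensor_sum_scale (c : K) (s : seq (E * F)) :
  tau [seq (c *: p.1, p.2) | p <- s] = c *: tau s.
Proof.
by rewrite big_map scaler_sumr; apply: eq_bigr => p _; rewrite /= linearZl_LR.
Qed.

Section Blocks.
Variables (x : nat -> E) (y : nat -> F) (phi : dual EF) (d : K).
Hypotheses (x1 : forall n, `|x n| <= 1) (y1 : forall n, `|y n| <= 1).
Hypotheses (d0 : 0 < d) (phid : forall n, d <= `|phi (tensor (x n) (y n))|).

Let X := {xi : dual E | `|xi| <= 1}.

Let mass (s : seq (E * F)) (xi : dual E) : K := \sum_(p <- s) `|xi p.1|.

(* Each s stands for a convex combination of tensors of index at least n, rotated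
   so that phi is at least d on them; mass s xi dominates the pairings of s with
   xi and the unit ball of the dual of F. The last condition replaces the
   requirement that the first components come from the x m with m >= n, and is
   stable under concatenation of lists. *)
Let C n : set (X -> R) := [set g | exists s : seq (E * F), [/\
  forall xi : X, real_scalar (g xi) = mass s (sval xi) :> K,
  forall p, p \in s -> `|p.2| <= 1,
  d <= phi (tau s)
  & forall (xi : dual E) (r : K), 0 <= r -> (forall m, (n <= m)%N -> `|xi (x m)| <= r) ->
    mass s xi <= r]].

Let mass_ge0 s xi : 0 <= mass s xi.
Proof. by rewrite /mass sumr_ge0. Qed.

Let mass_scale (c : K) s xi : mass [seq (c *: p.1, p.2) | p <- s] xi = `|c| * mass s xi.
Proof.
rewrite /mass big_map mulr_sumr; apply: eq_bigr => p _ /=.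
by rewrite linearZ normrM.
Qed.

Let C_nonempty n : C n !=set0.
Proof.
have [u [u1 uphi]] := rotation (phi (tensor (x n) (y n))).
exists (fun xi => real_part (mass [:: (u *: x n, y n)] (sval xi))), [:: (u *: x n, y n)]; split.
- by move=> xi; rewrite real_partK// mass_ge0.
- by move=> p; rewrite inE => /eqP -> /=; exact: y1.
- by rewrite big_seq1 /= linearZl_LR linearZ; have := phid n; rewrite -uphi.
- move=> xi r _ xr; rewrite /mass big_seq1 /= linearZ normrM u1 mul1r.
  exact: xr.
Qed.

Let C_decr n : C n.+1 `<=` C n.
Proof.
move=> g [s [gs s1 sd sr]]; exists s; split=> // xi r r0 xr.
by apply: sr => // m nm; apply: xr; exact: ltnW.
Qed.

Let C_01 n g xi : C n g -> 0 <= g xi <= 1.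
Proof.
move=> [s [gs s1 sd sr]].
rewrite -(real_scalar_ge0 (k := k)) -(real_scalar_le1 (k := k)) gs mass_ge0 /=.
apply: sr => // m _; apply: le_trans (operator_le _ _) _.
by rewrite mulr_ile1//; case: xi.
Qed.

Let C_convex n f g (t : R) : 0 <= t <= 1 -> C n f -> C n g ->
  C n (fun xi => (1 - t) * f xi + t * g xi).
Proof.
move=> /andP[t0 t1] [s [fs s1 sd sr]] [s' [gs s1' sd' sr']].
pose a : K := real_scalar (1 - t); pose b : K := real_scalar t.
have a0 : 0 <= a by rewrite real_scalar_ge0 subr_ge0.
have b0 : 0 <= b by rewrite real_scalar_ge0.
have ab1 : a + b = 1 by rewrite -rmorphD subrK rmorph1.
have mE xi : mass ([seq (a *: p.1, p.2) | p <- s] ++ [seq (b *: p.1, p.2) | p <- s']) xi =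
    a * mass s xi + b * mass s' xi.
  by rewrite {1}/mass big_cat -!/(mass _ _) !mass_scale !ger0_norm.
exists ([seq (a *: p.1, p.2) | p <- s] ++ [seq (b *: p.1, p.2) | p <- s']); split.
- by move=> xi; rewrite rmorphD !rmorphM mE -fs -gs.
- move=> p; rewrite mem_cat => /orP[] /mapP[q qs ->] /=; [exact: s1 | exact: s1'].
- rewrite big_cat !tensor_sum_scale linearD !linearZ -[d]mul1r -ab1 mulrDl.
  by rewrite lerD// ler_wpM2l.
- move=> xi r r0 xr; rewrite mE -[r]mul1r -ab1 mulrDl.
  by rewrite lerD// ler_wpM2l//; [exact: sr | exact: sr'].
Qed.

Let m := real_part (d / (2 * (`|phi| + 1)) : K).

Let phi1 : 0 < `|phi| + 1.
Proof. by rewrite ltr_wpDl. Qed.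

Let mE : real_scalar m = d / (2 * (`|phi| + 1)) :> K.
Proof. by rewrite real_partK// divr_ge0// ltW// mulr_gt0. Qed.

Let m0 : 0 < m.
Proof.
have : 0 < real_scalar m :> K by rewrite mE divr_gt0// mulr_gt0.
rewrite lt0r real_scalar_ge0 lt0r => /andP[+ ->]; rewrite andbT.
by apply: contraNneq => ->; rewrite rmorph0.
Qed.

(* The injective norm is a supremum over products of functionals; bounding the
   second components leaves a supremum over xi only. *)
Let C_sup g : C 0 g -> exists xi, m <= g xi.
Proof.
move=> [s [gs s1 sd sr]]; apply: contrapT => /forallNP gm.
have : injective_norm s <= real_scalar m.
  apply: injective_norm_le => xi psi xi1 psi1.
  have gxi : g (exist _ xi xi1) <= m.
    by rewrite leNgt; apply/negP => /ltW; exact: gm.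
  apply: (@le_trans _ _ (mass s xi)); last by rewrite -(gs (exist _ xi xi1)) ler_real_scalar.
  apply: le_trans (ler_norm_sum _ _ _) _; rewrite big_seq [leRHS]big_seq.
  apply: ler_sum => p ps; rewrite normrM ler_piMr//.
  by apply: le_trans (operator_le _ _) _; rewrite mulr_ile1// s1.
rewrite -(inj_tensor_norm tensorP) => taum.
have : d <= `|phi| * real_scalar m.
  apply: le_trans (sd) _; rewrite -[leLHS]ger0_norm; last exact: le_trans (ltW d0) sd.
  by apply: le_trans (operator_le _ _) _; rewrite ler_wpM2l.
rewrite mE mulrCA ler_pMr// ler_pdivlMr ?mulr_gt0// mul1r => phi2.
have : `|phi| < `|phi| by apply: lt_le_trans phi2; rewrite mulrDl mul1r ltr_wpDr// ltrDl.
by rewrite ltxx.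
Qed.

(** Points of the dual ball where the first blocks are all large cluster, along an
    ultrafilter, at a point eta where every block is large; but the n-th block is
    at most the supremum of the |eta (x m)| for m >= n. *)
Lemma tensor_not_weakly_null : ~ weakly_converges x 0.
Proof.
move=> x0.
have [g [Cg gm]] := convex_block_sequence C_nonempty C_decr C_01 C_convex m0 C_sup.
have /choice[xi xiP] := gm.
have [U [UU ooU]] := ultraFilterLemma (F := \oo) _.
have [eta [eta1 xieta]] := ultra_dual_cvg UU (fun n => svalP (xi n)).
have m4 : 0 < real_scalar (m / 4) :> K.
  rewrite lt0r real_scalar_ge0 divr_ge0 ?(ltW m0)// andbT.
  by rewrite rmorphM mulf_neq0// ?fmorph_eq0 ?invr_eq0 ?gt_eqF.
have m8 : 0 < real_scalar (m / 4) / 2 :> K by rewrite divr_gt0.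
have := x0 eta; rewrite linear0 => /cvgr0Pnorm_lt/(_ _ m8)[n _ xn].
have [s [gs _ _ sr]] := Cg n.
have : mass s eta <= real_scalar (m / 4) / 2.
  by apply: sr => [|j nj]; [exact: ltW | exact: ltW (xn j nj)].
apply/negP; rewrite -real_ltNge ?ger0_real ?mass_ge0 ?ltW//.
apply: (@lt_le_trans _ _ (real_scalar (m / 4))).
  by rewrite ltr_pdivrMr// ltr_pMr// ltr1n.
have cmass : mass s (sval (xi i)) @[i --> U] --> (mass s eta : K^o).
  rewrite /mass; elim: {gs sr} s => [|p s IH].
    by under eq_fun do rewrite big_nil; rewrite big_nil; exact: cvg_cst.
  under eq_fun do rewrite big_cons; rewrite big_cons.
  by apply: cvgD => //; apply: cvg_norm; exact: xieta.
apply: (cvg_ge _ cmass); apply: ooU; exists n => // i /= ni.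
by rewrite -gs ler_real_scalar; exact: xiP.
Qed.
End Blocks.

Lemma tensor_weakly_null (x : nat -> E) (y : nat -> F) :
  (forall n, `|x n| <= 1) -> (forall n, `|y n| <= 1) ->
  weakly_converges x 0 -> weakly_converges (fun n => tensor (x n) (y n)) 0.
Proof.
move=> x1 y1 x0 phi; rewrite linear0; apply: contrapT => nphi.
have [d [d0 [sigma [sn phid]]]] := not_cvg0_subsequence nphi.
have xs1 n : `|(x \o sigma) n| <= 1 by exact: x1.
have ys1 n : `|(y \o sigma) n| <= 1 by exact: y1.
exact: (tensor_not_weakly_null xs1 ys1 d0 phid) (weakly_null_reindex sn x0).
Qed.
End TensorNull.

(** * Products of functionals *)

Section Dense.
Lemma nbhs_dist_lt (K : numFieldType) (V : normedModType K) (u : V) (e : K) :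
  0 < e -> nbhs u [set v | `|u - v| < e].
Proof. by move=> e0; apply: cvgr_dist_lt e0; exact: cvg_id. Qed.

Lemma dense_nbhs (T : topologicalType) (A B : set T) (u : T) :
  dense A -> nbhs u B -> exists2 v, A v & B v.
Proof.
move=> dA; rewrite nbhsE => -[W [Wo Wu] WB].
have [v [Wv Av]] : W `&` A !=set0 by apply: dA => //; exists u.
by exists v; [|exact: WB].
Qed.

End Dense.

Section Extension.
Context {R : realType} {k : scalar_kind}.
Local Notation K := (scalars R k).
Variables (S : Type) (V : normedModType K) (tau : S -> V) (L : S -> K^o) (M : K).
Hypotheses (M0 : 0 <= M) (tau_dense : dense (range tau)).
Hypothesis tauL : forall c s1 s2, exists s,
  tau s = c *: tau s1 + tau s2 /\ L s = c * L s1 + L s2.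
Hypothesis LM : forall s, `|L s| <= M * `|tau s|.

Let approx (u : V) (B : set V) : nbhs u B -> exists s, B (tau s).
Proof. by move=> /(dense_nbhs tau_dense)[_ [s _ <-] Bs]; exists s. Qed.

Let approx_dist (u : V) e : 0 < e -> exists s, `|u - tau s| < e.
Proof. by move=> /(nbhs_dist_lt u)/approx. Qed.

Let LB s s' : `|L s - L s'| <= M * `|tau s - tau s'|.
Proof.
have [t [tE LE]] := tauL (-1) s' s.
move: (LM t); rewrite tE LE scaleN1r mulN1r.
by rewrite ![- _ + _]addrC.
Qed.

Let extends u (c : K^o) := forall s, `|c - L s| <= M * `|u - tau s|.

Let extends_ex u : exists c, extends u c.
Proof.
pose G := filter_from (nbhs u) (fun B => tau @^-1` B).
have GF : ProperFilter G.
  apply: filter_from_proper; last by move=> B /approx.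
  apply: filter_from_filter; first by exists setT; exact: filterT.
  by move=> A B nA nB; exists (A `&` B) => //; exact: filterI.
have [U [UU GU]] := ultraFilterLemma GF.
have dist_small e : 0 < e -> \forall s \near U, `|u - tau s| < e.
  move=> e0; apply: GU; exists [set v | `|u - v| < e] => //.
  exact: nbhs_dist_lt.
have Lcvg : cvg (L @ U).
  have UB := dist_small 1 ltr01.
  (* L is bounded only where tau stays near u, a set of U. *)
  pose L' s : K^o := if `|u - tau s| < 1 then L s else 0.
  have : cvg (L' @ U).
    apply: (@ultra_bounded_cvg _ _ _ _ _ (M * (`|u| + 1))) => s.
    rewrite /L'; case: ifP => us; last by rewrite normr0 mulr_ge0// addr_ge0.
    apply: le_trans (LM s) _; rewrite ler_wpM2l//.
    rewrite -[tau s](subKr u) (le_trans (ler_normB _ _))// lerD2l.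
    exact: ltW.
  move=> /cvg_ex[l Ll]; apply/cvg_ex; exists l.
  by apply: cvg_trans Ll; apply: near_eq_cvg; apply: filterS UB => s us; rewrite /L' us.
have /cvg_ex[c Lc] := Lcvg; exists c => s.
apply/ler_addgt0Pr => e e0.
have M1 : 0 < M + 1 by rewrite ltr_wpDl.
have e1 : 0 < e / (M + 1) by rewrite divr_gt0.
have h : L t - L s @[t --> U] --> c - L s by apply: cvgB => //; exact: cvg_cst.
apply: (cvg_norm_le _ h); apply: filterS (dist_small _ e1) => t ut.
apply: le_trans (LB t s) _.
apply: (@le_trans _ _ (M * `|u - tau s| + M * (e / (M + 1)))).
  rewrite -mulrDr ler_wpM2l// -[tau t](subKr u) addrAC.
  by rewrite (le_trans (ler_normB _ _))// lerD2l ltW.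
rewrite lerD2l mulrCA ger_pMr// ler_pdivrMr// mul1r lerDl.
exact: ler01.
Qed.

(** The family tau stands for the formal combinations that span a dense subspace,
    and L for a functional on it that tau need not separate a priori. The value of
    the extension at u is a limit of L along an ultrafilter on the index set whose
    image converges to u; it is characterised by the Lipschitz bound [extends], from
    which linearity follows by approximation. *)
Lemma dense_extension : exists Phi : dual V, (forall s, Phi (tau s) = L s) /\ `|Phi| <= M.
Proof.
have /choice[T TP] := extends_ex.
have Ttau s : T (tau s) = L s.
  by apply/eqP; rewrite -subr_eq0 -normr_le0; have := TP (tau s) s; rewrite subrr normr0 mulr0.
have lT : linear T.
  move=> c u v; apply/eqP; rewrite -subr_eq0 -normr_le0.
  apply/ler_addgt0Pr => e e0; rewrite add0r.
  pose Q := (M + 1) * (`|c| + 1) * 4.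
  have Q0 : 0 < Q by rewrite !mulr_gt0// ltr_wpDl.
  have d0 : 0 < e / Q by rewrite divr_gt0.
  have [s1 us1] := approx_dist u d0; have [s2 vs2] := approx_dist v d0.
  have [s [sE LE]] := tauL c s1 s2.
  have h := TP (c *: u + v) s; have h1 := TP u s1; have h2 := TP v s2.
  have -> : T (c *: u + v) - (c *: T u + T v) =
      (T (c *: u + v) - L s) - (c * (T u - L s1) + (T v - L s2)).
    by rewrite LE -[c *: T u]/(c * T u); ring.
  have MM1 : M <= M + 1 by rewrite lerDl.
  have cc1 : `|c| <= `|c| + 1 by rewrite lerDl.
  have b1 : `|c| * (M * `|u - tau s1|) <= (M + 1) * (`|c| + 1) * (e / Q).
    rewrite mulrA [`|c| * M]mulrC.
    by rewrite ler_pM ?mulr_ge0//; [rewrite ler_pM | exact: ltW].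
  have b2 : M * `|v - tau s2| <= (M + 1) * (`|c| + 1) * (e / Q).
    apply: ler_pM => //; last exact: ltW.
    by apply: le_trans MM1 _; rewrite ler_peMr ?lerDr// ltW// ltr_wpDl.
  have b3 : M * `|c *: u + v - tau s| <= `|c| * (M * `|u - tau s1|) + M * `|v - tau s2|.
    rewrite sE opprD addrACA -scalerBr mulrCA -mulrDr ler_wpM2l//.
    by rewrite (le_trans (ler_normD _ _))// normrZ.
  have b4 : e = (M + 1) * (`|c| + 1) * (e / Q) * 4.
    by rewrite mulrAC -/Q mulrC divfK// gt_eqF.
  rewrite (le_trans (ler_normB _ _))//.
  apply: (@le_trans _ _ ((`|c| * (M * `|u - tau s1|) + M * `|v - tau s2|) +
     (`|c| * (M * `|u - tau s1|) + M * `|v - tau s2|))).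
    rewrite lerD ?(le_trans h)// (le_trans (ler_normD _ _))// normrM.
    by rewrite lerD// ler_wpM2l.
  set q := (M + 1) * (`|c| + 1) * (e / Q) in b1 b2 b4.
  rewrite [leRHS]b4.
  have -> : q * 4 = (q + q) + (q + q) by ring.
  by rewrite !lerD.
have TM u : `|T u| <= M * `|u|.
  have [s _] := approx_dist u ltr01.
  (* An index of the vector 0. *)
  have [s0 [s0E L0]] := tauL (-1) s s.
  move: (TP u s0); rewrite s0E L0 scaleN1r mulN1r !addNr.
  by rewrite !subr0.
exists (mk_operator lT TM); split; first exact: Ttau.
exact: operator_norm_le.
Qed.
End Extension.

Section Products.
Context {R : realType} {k : scalar_kind}.
Local Notation K := (scalars R k).
Context {E F EF : completeNormedModType K} {tensor : {bilinear E -> F -> EF}}.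
Hypothesis tensorP : is_injective_tensor_product tensor.

Lemma tensor_functional_ex (xi : dual E) (psi : dual F) : exists Phi : dual EF,
  (forall x y, Phi (tensor x y) = xi x * psi y) /\ `|Phi| <= `|xi| * `|psi|.
Proof.
pose tau (s : seq (E * F)) := \sum_(p <- s) tensor p.1 p.2.
have [|c s1 s2|s|Phi [Phitau PhiM]] :=
  @dense_extension R k (seq (E * F)) EF tau (pairing xi psi) (`|xi| * `|psi|) _
    (inj_tensor_dense tensorP).
- by rewrite mulr_ge0.
- exists ([seq (c *: p.1, p.2) | p <- s1] ++ s2); rewrite /tau /pairing !big_cat /=.
  rewrite tensor_sum_scale big_map mulr_sumr; split=> //; congr (_ + _).
  by apply: eq_bigr => p _; rewrite linearZ /= -mulrA.
- by rewrite /tau (inj_tensor_norm tensorP); exact: pairing_le.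
exists Phi; split=> // x y.
by have := Phitau [:: (x, y)]; rewrite /tau /pairing !big_seq1.
Qed.

(** The uniqueness that makes [tensor_functional] bilinear. *)
Lemma dual_tensor_eq (Phi Psi : dual EF) :
  (forall x y, Phi (tensor x y) = Psi (tensor x y)) -> Phi = Psi.
Proof.
move=> PP; apply: val_inj; apply/funext => u /=.
have tauPP s : Phi (\sum_(p <- s) tensor p.1 p.2) = Psi (\sum_(p <- s) tensor p.1 p.2).
  by rewrite !linear_sum; apply: eq_bigr => p _; exact: PP.
apply/eqP; rewrite -subr_eq0 -normr_le0; apply/ler_addgt0Pr => e e0; rewrite add0r.
pose D : dual EF := Phi - Psi; have D1 : 0 < `|D| + 1 by rewrite ltr_wpDl.
have uB : nbhs u [set v | `|u - v| < e / (`|D| + 1)].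
  by apply: nbhs_dist_lt; rewrite divr_gt0.
have [_ [s _ <-] us] := dense_nbhs (inj_tensor_dense tensorP) uB.
have -> : Phi u - Psi u = D (u - \sum_(p <- s) tensor p.1 p.2).
  by rewrite raddfB -[X in _ = _ - X]/(Phi _ - Psi _) tauPP subrr subr0.
apply: le_trans (operator_le _ _) _.
apply: (@le_trans _ _ ((`|D| + 1) * (e / (`|D| + 1)))).
  by rewrite ler_pM// ?lerDl// ltW.
by rewrite mulrC divfK// gt_eqF.
Qed.

Definition tensor_functional (xi : dual E) (psi : dual F) : dual EF :=
  sval (cid (tensor_functional_ex xi psi)).

Lemma tensor_functionalE xi psi x y :
  tensor_functional xi psi (tensor x y) = xi x * psi y.
Proof. by rewrite /tensor_functional; case: cid => Phi [+ _] /=; apply. Qed.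

Lemma tensor_functional_norm xi psi : `|tensor_functional xi psi| <= `|xi| * `|psi|.
Proof. by rewrite /tensor_functional; case: cid => Phi [_ +] /=. Qed.

Section BidualOperator.
Variable z : bidual EF.

Lemma tensor_functional_linearl psi : linear (fun xi : dual E => z (tensor_functional xi psi) : K^o).
Proof.
move=> c xi xi'; rewrite -linearP; congr (z _); apply: dual_tensor_eq => x y.
rewrite -[RHS]/(c * tensor_functional xi psi (tensor x y) + tensor_functional xi' psi (tensor x y)).
by rewrite !tensor_functionalE mulrA -mulrDl.
Qed.

Lemma tensor_functional_boundl psi (xi : dual E) :
  `|z (tensor_functional xi psi)| <= `|z| * `|psi| * `|xi|.
Proof.
apply: le_trans (operator_le _ _) _; rewrite -mulrA ler_wpM2l// mulrC.
exact: tensor_functional_norm.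
Qed.

Definition bidual_operator_fun (psi : dual F) : bidual E :=
  mk_operator (tensor_functional_linearl psi) (tensor_functional_boundl psi).

Lemma bidual_operator_linear : linear bidual_operator_fun.
Proof.
move=> c psi psi'; apply: val_inj; apply/funext => xi /=.
rewrite -[RHS]/(c * z (tensor_functional xi psi) + z (tensor_functional xi psi')).
rewrite -[LHS]/(z (tensor_functional xi (c *: psi + psi'))).
rewrite -[c * _]/(c *: (z _ : K^o)) -linearP; congr (z _); apply: dual_tensor_eq => x y.
rewrite -[RHS]/(c * tensor_functional xi psi (tensor x y) + tensor_functional xi psi' (tensor x y)).
by rewrite !tensor_functionalE mulrCA -mulrDr.
Qed.

Lemma bidual_operator_bound psi : `|bidual_operator_fun psi| <= `|z| * `|psi|.
Proof.
by apply: operator_norm_le; [rewrite mulr_ge0 | exact: tensor_functional_boundl].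
Qed.

Definition bidual_operator : operator (dual F) (bidual E) :=
  mk_operator bidual_operator_linear bidual_operator_bound.
End BidualOperator.

Lemma tensor_functional_weakly_null (xi : nat -> dual E) (psi : nat -> dual F) :
  (forall T : operator (dual F) (bidual E), completely_continuous T) ->
  (forall n, `|xi n| <= 1) -> weakly_converges psi 0 ->
  weakly_converges (fun n => tensor_functional (xi n) (psi n)) 0.
Proof.
move=> Lcc xi1 psi0 z; rewrite linear0.
have := completely_continuous_weakly_null (Lcc (bidual_operator z)) psi0.
move=> Tpsi; apply/cvgr0Pnorm_lt => e e0; move/cvgr0Pnorm_lt/(_ e e0): Tpsi.
apply: filterS => n; apply: le_lt_trans.
rewrite -[z _]/(bidual_operator z (psi n) (xi n)).
by apply: le_trans (operator_le _ _) _; rewrite ler_piMr.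
Qed.
End Products.


(** * The theorem *)

Theorem theorem12 (R : realType) (k : scalar_kind)
    (E F EF : completeNormedModType (scalars R k))
    (tensor : {bilinear E -> F -> EF}) :
  is_injective_tensor_product tensor ->
  ~ schur_property E ->
  ~ schur_property (dual F) ->
  (forall T : operator (dual F) (bidual E), completely_continuous T) ->
  ~ dunford_pettis_property EF.
Proof.
move=> tensorP /weakly_null_norm1[x [x1 x0]] /weakly_null_norm1[psi [psi1 psi0]] Lcc DP.
have /choice[xi xiP] : forall n, exists phi : dual E, `|phi| <= 1 /\ `|phi (x n)| = `|x n|.
  by move=> n; exact: norming_functional.
have /choice[y yP] : forall n, exists v : F, `|v| <= 1 /\ 2^-1 <= `|psi n v|.
  move=> n; apply: contrapT => /forallNP nv.
  have : `|psi n| <= 2^-1.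
    apply: op_norm_le => v v1; rewrite real_leNgt// ?ger0_real//.
    by apply/negP => /ltW v2; apply: (nv v).
  rewrite psi1; apply/negP; rewrite -real_ltNge ?ger0_real//.
  by rewrite invf_lt1// ltr1n.
pose Phi n := tensor_functional tensorP (xi n) (psi n).
have Phi1 n : `|Phi n| <= 1.
  apply: le_trans (tensor_functional_norm _ _ _) _.
  by rewrite psi1 mulr1; have [] := xiP n.
have Phi0 : weakly_converges Phi 0.
  by apply: tensor_functional_weakly_null => // n; have [] := xiP n.
have xy0 : weakly_converges (fun n => tensor (x n) (y n)) 0.
  apply: tensor_weakly_null => // n; first by rewrite x1.
  by have [] := yP n.
have := dunford_pettis_pairing Phi0 Phi1 DP xy0.
have half0 : 0 < 2^-1 :> scalars R k by rewrite invr_gt0.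
move=> /cvgr0Pnorm_lt/(_ _ half0)/filter_ex[n].
rewrite tensor_functionalE normrM (xiP n).2 x1 mul1r => /lt_le_trans/(_ (yP n).2).
by rewrite ltxx.
Qed.
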